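(* Let $0<\lambda<1$, $0<\alpha\le 1$, $D=[0,2\pi]^2$, and $\Psi=H_{\alpha\alpha}(D)$. Let $x_k=2k\pi/n$ for $k=0,\dots,n$, $x_k'=(x_k+x_{k+1})/2$ and $\Delta_{kl}=[x_k,x_{k+1}]\times[x_l,x_{l+1}]$ for $k,l=0,\dots,n-1$. Among all cubature formulas $$(Kf)(s_1,s_2)=\sum_{k_1=1}^{n}\sum_{k_2=1}^{n}p_{k_1k_2}(s_1,s_2)f(x_{k_1},y_{k_2})+R_{nn}(f;p_{k_1k_2};x_{k_1},y_{k_2};s_1,s_2)$$ with arbitrary coefficients and nodes, the formula $$(Kf)(s_1,s_2)=\sum_{k=0}^{n-1}\sum_{l=0}^{n-1} f(x_k',x_l')\iint_{\Delta_{kl}}\frac{d\sigma_1\,d\sigma_2}{\left(\sin^2\frac{\sigma_1-s_1}{2}+\sin^2\frac{\sigma_2-s_2}{2}\right)^{\lambda}}+R_{nn},$$ which has the error on the class $\Psi$ $$R_{nn}[\Psi]=\frac{(2+o(1))\gamma}{1+\alpha}\left(\frac{\pi}{n}\right)^{\alpha},\qquad n\to\infty,$$ is asymptotically optimal on $\Psi$. Here $\gamma=\int_0^{2\pi}\int_0^{2\pi}\frac{ds_1ds_2}{(\sin^2(s_1/2)+\sin^2(s_2/2))^{\lambda}}$.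
   Context: $(Kf)(s_1,s_2)=\int_0^{2\pi}\int_0^{2\pi}\frac{f(\sigma_1,\sigma_2)\,d\sigma_1d\sigma_2}{\left(\sin^2\frac{\sigma_1-s_1}{2}+\sin^2\frac{\sigma_2-s_2}{2}\right)^{\lambda}}$ for $0\le s_1,s_2\le 2\pi$. $H_{\alpha\alpha}(D)$ is the class of functions $f$ on $D=[0,2\pi]^2$ with $|f(x_1,x_2)-f(y_1,y_2)|\le |x_1-y_1|^{\alpha}+|x_2-y_2|^{\alpha}$ for all $(x_1,x_2),(y_1,y_2)\in D$. For a cubature formula with remainder $R_{nn}(f;\cdot;s_1,s_2)$ (exact value minus cubature sum), its error on a function is $\sup_{(s_1,s_2)\in[0,2\pi]^2}|R_{nn}(f;\cdot;s_1,s_2)|$, and its error on a class $\Psi$ is the supremum of this over $f\in\Psi$. Let $\zeta_{nn}[\Psi]$ be the infimum of the error on $\Psi$ over all choices of coefficients (functions of $(s_1,s_2)$) and nodes $x_1,\dots,x_n,y_1,\dots,y_n\in[0,2\pi]$. A formula is asymptotically optimal on $\Psi$ if the ratio of its error on $\Psi$ to $\zeta_{nn}[\Psi]$ tends to $1$ as $n\to\infty$. *)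

(* Defs.v *)
From HB Require Import structures.
From mathcomp Require Import all_boot all_order all_algebra.
From mathcomp Require Import all_classical all_reals all_analysis.
From mathcomp Require Import ring lra.

Set Implicit Arguments.
Unset Strict Implicit.
Unset Printing Implicit Defensive.

Import Order.TTheory GRing.Theory Num.Theory.
Import numFieldNormedType.Exports.

Local Open Scope classical_set_scope.
Local Open Scope ring_scope.

Definition square (R : realType) : set (R * R) :=
  `[0, 2 * pi]%classic `*` `[0, 2 * pi]%classic.

Arguments square R : clear implicits.

Notation leb2 R := (@lebesgue_measure R \x @lebesgue_measure R)%E.

(* At [sigma = s] (mod 2 pi) the value is [(0 `^ lambda)^-1 = 0] for
   [lambda != 0]; for each [s] only finitely many [sigma] in the square are
   concerned. *)
Definition singular_kernel (R : realType) (lambda : R) (sigma s : R * R) : R :=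
  ((sin ((sigma.1 - s.1) / 2) ^+ 2 + sin ((sigma.2 - s.2) / 2) ^+ 2)
     `^ lambda)^-1.

Definition Kop (R : realType) (lambda : R) (f : R * R -> R) (s : R * R) : R :=
  \int[leb2 R]_(sigma in square R) (f sigma * singular_kernel lambda sigma s).

Definition gamma (R : realType) (lambda : R) : R :=
  \int[leb2 R]_(s in square R)
    ((sin (s.1 / 2) ^+ 2 + sin (s.2 / 2) ^+ 2) `^ lambda)^-1.

(* Functions on the square are represented by total functions; everything
   below depends only on their values on the square. *)
Definition holder_class (R : realType) (alpha : R) : set (R * R -> R) :=
  [set f | forall x y, square R x -> square R y ->
     `|f x - f y| <= `|x.1 - y.1| `^ alpha + `|x.2 - y.2| `^ alpha].

Record cubature (R : realType) (n : nat) := Cubature {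
  coef : 'I_n -> 'I_n -> R * R -> R;
  xnode : 'I_n -> R;
  ynode : 'I_n -> R;
  xnode_in : forall k, 0 <= xnode k <= 2 * pi;
  ynode_in : forall k, 0 <= ynode k <= 2 * pi }.

Definition remainder (R : realType) (lambda : R) (n : nat) (C : cubature R n)
    (f : R * R -> R) (s : R * R) : R :=
  Kop lambda f s
  - \sum_(k1 < n) \sum_(k2 < n) coef C k1 k2 s * f (xnode C k1, ynode C k2).

Definition error_on (R : realType) (lambda : R) (n : nat) (C : cubature R n)
    (f : R * R -> R) : \bar R :=
  ereal_sup [set (`|remainder lambda C f s|)%:E | s in square R].

Definition class_error (R : realType) (lambda : R) (n : nat)
    (C : cubature R n) (Psi : set (R * R -> R)) : \bar R :=
  ereal_sup [set error_on lambda C f | f in Psi].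

Definition zeta (R : realType) (lambda : R) (n : nat)
    (Psi : set (R * R -> R)) : \bar R :=
  ereal_inf [set class_error lambda C Psi | C in [set: cubature R n]].

(* The quotient is taken in the extended reals, where [+oo / +oo],
   [0 / 0] and [0 / +oo] are all [0], so convergence to [1] forces both errors
   to be eventually finite and nonzero. *)
Definition asymptotically_optimal (R : realType) (lambda : R)
    (Psi : set (R * R -> R)) (C : forall n, cubature R n) : Prop :=
  (class_error lambda (C n) Psi / zeta lambda n Psi)%E @[n --> \oo] --> 1%E.

Definition grid (R : realType) (n k : nat) : R := 2 * k%:R * pi / n%:R.

Definition midpoint (R : realType) (n k : nat) : R :=
  (grid R n k + grid R n k.+1) / 2.

Definition cell (R : realType) (n k l : nat) : set (R * R) :=
  `[grid R n k, grid R n k.+1]%classic `*` `[grid R n l, grid R n l.+1]%classic.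

Arguments cell R n k l : clear implicits.

Lemma grid_in (R : realType) (n k : nat) :
  (k <= n)%N -> 0 <= grid R n k <= 2 * pi.
Proof.
case: n => [|n] kn.
  by rewrite /grid invr0 mulr0 lexx mulr_ge0 // pi_ge0.
rewrite /grid; apply/andP; split.
  by rewrite !mulr_ge0 // ?pi_ge0 // invr_ge0.
rewrite ler_pdivrMr ?ltr0n // -!mulrA ler_pM2l // mulrC.
by rewrite ler_wpM2l ?pi_ge0 // ler_nat.
Qed.

Lemma midpoint_in (R : realType) (n : nat) (k : 'I_n) :
  0 <= midpoint R n k <= 2 * pi.
Proof.
have /andP[a0 a1] := @grid_in R n k (ltnW (ltn_ord k)).
have /andP[b0 b1] := @grid_in R n k.+1 (ltn_ord k).
rewrite /midpoint; apply/andP; split; lra.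
Qed.

Definition midpoint_cubature (R : realType) (lambda : R) (n : nat) :
    cubature R n :=
  {| coef := fun k l s =>
       \int[leb2 R]_(sigma in cell R n k l) singular_kernel lambda sigma s;
     xnode := fun k => midpoint R n k;
     ynode := fun l => midpoint R n l;
     xnode_in := @midpoint_in R n;
     ynode_in := @midpoint_in R n |}.

(* Main.v *)
Require Import Defs.
From mathcomp Require Import all_boot all_order all_algebra.
From mathcomp Require Import all_classical all_reals all_analysis.
Import Order.TTheory GRing.Theory Num.Theory.
Import numFieldNormedType.Exports.
From mathcomp Require Import measurable_realfun.
From mathcomp Require Import ring lra.
Local Open Scope classical_set_scope.
Local Open Scope ring_scope.
Set Implicit Arguments.
Unset Strict Implicit.
Unset Printing Implicit Defensive.

(** Write [r = pi / n], [g0 = gamma lambda] and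
    [B n = 2 * g0 * r `^ alpha / (1 + alpha)].  The midpoint formula and the
    best formula are squeezed between the same two bounds:
    [B n <= zeta <= error of the midpoint formula <= B n * (1 + o(1))].

    Both inequalities rest on one reduction.  The kernel only depends on the
    differences [sigma - s] modulo the period, so integrating it in one
    variable gives a periodic function [profile] of the other difference, whose
    integral over a period is [g0].  Hence a sum [a(sigma_1) + b(sigma_2)]
    integrates against the kernel to two one-dimensional integrals
    [ge0_integral_split_kernel], and everything else happens on the line.

    Lower bound [class_error_ge].  For arbitrary nodes, the function
    [f(sigma) = min_i |sigma_1 - x_i|^alpha + min_j |sigma_2 - y_j|^alpha],
    capped by [r `^ alpha] in each variable, is in the class and vanishes at
    all nodes, so its remainder is its full integral, whatever the
    coefficients.  The supremum over [s] is at least the mean over the diagonal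
    [s = (u, u)]; by Tonelli this mean only involves [g0] and the integrals of
    the two minima.  Bumps of height [r `^ alpha] and radius [r] around the
    nodes cover the deficit [r `^ alpha - min], which gives the sharp lower
    bound [2 * pi * r `^ alpha / (1 + alpha)] for these integrals
    [integral_node_gauge_ge].

    Upper bound [remainder_midpoint_le].  For [f] in the class the remainder is
    at most the integral of the kernel against the powers [alpha] of the
    distances to the nearest midpoints, that is, against functions oscillating
    at scale [1/n] with mean [r `^ alpha / (1 + alpha)].  The point is uniformity in [s], although the
    kernel is singular at [s].  The kernel is split into a regularised one,
    with [d] added to its base, and a remainder of small mass:
    [w^-lambda <= (w + d)^-lambda + d^q * w^-(lambda + q)]
    [reg_kernel_split].  The regularised kernel varies by a factor at most
    [1 + 2 * r / d] on a cell [reg_kernel_harnack], so there the oscillating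
    function may be replaced by its mean [integral_cell_harnack].  With
    [d = sqrt r] and [lambda + q < 1] the relative error tends to 0.  The
    finiteness of the masses, for all exponents below 1, comes from
    [x^2 + y^2 >= x * y], which bounds the kernel by a product of integrable
    functions of one variable [total_mass_lty]. *)

(** * Lebesgue integrals on the line: translation, reflection, subdivision *)

Section Lebesgue1D.
Context {R : realType}.
Notation mu := (@lebesgue_measure R).

(** Both measures agree on half-open intervals, which determines them. *)
Lemma lebesgue_measure_shift (c : R) (A : set R) : measurable A ->
  mu ((fun x : R => x + c) @^-1` A) = mu A.
Proof.
move=> mA.
have mf : measurable_fun [set: measurableTypeR R]
    ((fun x => x + c) : measurableTypeR R -> measurableTypeR R).
  exact: (@measurable_funD _ R).
pose nu := measure_function_pushforward__canonical__measure_function_Measure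
  (mu : measure (measurableTypeR R) R) mf.
symmetry; apply: (@lebesgue_measure_unique R nu) => //= _ [[a b] _ <-].
rewrite /nu /= /pushforward.
have -> : (fun x : R => x + c) @^-1` `]a, b] = `]a - c, b - c]%classic.
  by apply/seteqP; split => x /=; rewrite !in_itv/= ltrBlDr lerBrDr.
rewrite !lebesgue_measure_itv/= !lte_fin ltrD2r; case: ifP => // _.
rewrite -!EFinB; congr EFin; lra.
Qed.

Lemma lebesgue_measure_opp (A : set R) : measurable A ->
  mu ((fun x : R => - x) @^-1` A) = mu A.
Proof.
move=> mA.
have mf : measurable_fun [set: measurableTypeR R]
    ((fun x => - x) : measurableTypeR R -> measurableTypeR R).
  exact: oppr_measurable.
pose nu := measure_function_pushforward__canonical__measure_function_Measure
  (mu : measure (measurableTypeR R) R) mf.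
symmetry; apply: (@lebesgue_measure_unique R nu) => //= _ [[a b] _ <-].
rewrite /nu /= /pushforward.
have -> : (fun x : R => - x) @^-1` `]a, b] = `[- b, - a[%classic.
  by apply/seteqP; split => x /=; rewrite !in_itv/= ltrNr lerNl andbC.
rewrite !lebesgue_measure_itv/= !lte_fin ltrN2; case: ifP => // _.
rewrite -!EFinB; congr EFin; lra.
Qed.

Lemma ge0_integral_shift (c : R) (D : set R) (f : R -> \bar R) :
  measurable D -> measurable_fun D f -> (forall x, D x -> (0 <= f x)%E) ->
  (\int[mu]_(x in (fun x : R => x + c)%R @^-1` D) f (x + c)%R = \int[mu]_(x in D) f x)%E.
Proof.
move=> mD mf f0.
have mg : measurable_fun [set: measurableTypeR R]
    (+%R^~ c : measurableTypeR R -> measurableTypeR R).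
  exact: (@measurable_funD _ R).
transitivity (\int[pushforward (mu : measure (measurableTypeR R) R)
    (+%R^~ c : measurableTypeR R -> measurableTypeR R)]_(x in D) f x)%E.
  symmetry; apply: (ge0_integral_pushforward mg) => //.
  by move=> x /[!inE]; exact: f0.
apply: eq_measure_integral => A mA _; exact: lebesgue_measure_shift.
Qed.

Lemma ge0_integral_opp (D : set R) (f : R -> \bar R) :
  measurable D -> measurable_fun D f -> (forall x, D x -> (0 <= f x)%E) ->
  (\int[mu]_(x in (fun x : R => - x)%R @^-1` D) f (- x)%R = \int[mu]_(x in D) f x)%E.
Proof.
move=> mD mf f0.
have mg : measurable_fun [set: measurableTypeR R]
    (-%R : measurableTypeR R -> measurableTypeR R).
  exact: oppr_measurable.
transitivity (\int[pushforward (mu : measure (measurableTypeR R) R)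
    (-%R : measurableTypeR R -> measurableTypeR R)]_(x in D) f x)%E.
  symmetry; apply: (ge0_integral_pushforward mg) => //.
  by move=> x /[!inE]; exact: f0.
apply: eq_measure_integral => A mA _; exact: lebesgue_measure_opp.
Qed.

Lemma ge0_integral_itv_shift (a b c : R) (f : R -> \bar R) :
  measurable_fun setT f -> (forall x, (0 <= f x)%E) ->
  (\int[mu]_(x in `[a, b]) f (x + c)%R = \int[mu]_(x in `[(a + c)%R, (b + c)%R]) f x)%E.
Proof.
have mI : measurable `[(a + c)%R, (b + c)%R]%classic by [].
move=> mf f0; rewrite -[RHS](ge0_integral_shift c mI); last 2 first.
- exact: measurable_funTS.
- by [].
congr (integral _ _ _); apply/seteqP; split => x /=; rewrite !in_itv/= !lerD2r//.
Qed.

Lemma ge0_integral_itv_opp (a b : R) (f : R -> \bar R) :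
  measurable_fun setT f -> (forall x, (0 <= f x)%E) ->
  (\int[mu]_(x in `[a, b]) f (- x)%R = \int[mu]_(x in `[(- b)%R, (- a)%R]) f x)%E.
Proof.
have mI : measurable `[(- b)%R, (- a)%R]%classic by [].
move=> mf f0; have <- := ge0_integral_opp mI (measurable_funTS mf) (fun x _ => f0 x).
congr (integral _ _ _); apply/seteqP.
by split => x /=; rewrite !in_itv/= !lerN2 andbC.
Qed.

Lemma ge0_integral_itv_split (a b c : R) (f : R -> \bar R) :
  a <= b -> b <= c ->
  measurable_fun setT f -> (forall x, (0 <= f x)%E) ->
  (\int[mu]_(x in `[a, c]) f x =
    \int[mu]_(x in `[a, b]) f x + \int[mu]_(x in `[b, c]) f x)%E.
Proof.
move=> ab bc mf f0.
rewrite (@itv_bndbnd_setU _ _ _ (BLeft b)) ?bnd_simp//.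
rewrite ge0_integral_setU//=; last 2 first.
- exact: measurable_funTS.
- apply/disj_setPS => x [/=]; rewrite !in_itv/= => /andP[_ xb] /andP[].
  by rewrite leNgt xb.
by rewrite integral_itv_bndo_bndc//; exact: measurable_funTS.
Qed.

Lemma ge0_integral_itv_subdivision (p : nat -> R) (n : nat) (f : R -> \bar R) :
  {homo p : i j / (i <= j)%N >-> i <= j} ->
  measurable_fun setT f -> (forall x, (0 <= f x)%E) ->
  (\int[mu]_(x in `[p 0%N, p n]) f x =
    \sum_(k < n) \int[mu]_(x in `[p k, p k.+1]) f x)%E.
Proof.
move=> hp mf f0; elim: n => [|n IH].
  by rewrite big_ord0 set_itv1 integral_set1.
by rewrite big_ord_recr/= -IH [LHS](@ge0_integral_itv_split _ (p n))// hp.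
Qed.

(** A translation by [s] cuts the period into two pieces; the one pushed below
    0 is brought back by one full period. *)
Lemma ge0_integral_periodic_shift (p s : R) (f : R -> \bar R) :
  0 <= s <= p -> measurable_fun setT f -> (forall x, (0 <= f x)%E) ->
  (forall x, f (x + p) = f x) ->
  (\int[mu]_(x in `[0%R, p]) f (x - s)%R = \int[mu]_(x in `[0%R, p]) f x)%E.
Proof.
move=> /andP[s0 sp] mf f0 fp.
rewrite (ge0_integral_itv_shift _ _ (- s))// add0r.
rewrite (@ge0_integral_itv_split _ 0) ?oppr_le0 ?subr_ge0//.
rewrite [RHS](@ge0_integral_itv_split _ (p - s)) ?gerBl ?subr_ge0//.
rewrite addeC; congr (_ + _)%E.
have -> : (\int[mu]_(x in `[(- s)%R, 0%R]) f x =
    \int[mu]_(x in `[(- s)%R, 0%R]) f (x + p)%R)%E.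
  by apply: eq_integral => x _; rewrite fp.
by rewrite ge0_integral_itv_shift// add0r (addrC _ p).
Qed.

End Lebesgue1D.

(** * Iterated integrals over rectangles *)

Section Tonelli.
Context {R : realType}.
Notation mu := (@lebesgue_measure R).

Lemma ge0_integral_setX (A B : set R) (F : R * R -> \bar R) :
  measurable A -> measurable B ->
  measurable_fun setT F -> (forall z, (0 <= F z)%E) ->
  (\int[leb2 R]_(z in A `*` B) F z =
    \int[mu]_(x in A) \int[mu]_(y in B) F (x, y))%E.
Proof.
move=> mA mB mF F0.
have mAB : measurable (A `*` B) by exact: measurableX.
rewrite integral_mkcond fubini_tonelli1; last 2 first.
- by apply/(measurable_restrictT _ _).1 => //; exact: measurable_funTS.
- by move=> z; apply: erestrict_ge0.
rewrite [RHS]integral_mkcond; apply: eq_integral => x _.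
rewrite /fubini_F /patch; case: ifPn => xA.
- rewrite [RHS]integral_mkcond; apply: eq_integral => y _.
  rewrite /patch; congr (if _ then _ else _).
  by rewrite in_setX xA.
- apply: integral0_eq => y _; rewrite ifF//.
  by rewrite in_setX (negbTE xA).
Qed.

Lemma ge0_measurable_integralr (B : set R) (F : R * R -> \bar R) :
  measurable B -> measurable_fun setT F -> (forall z, (0 <= F z)%E) ->
  measurable_fun setT (fun x => \int[mu]_(y in B) F (x, y))%E.
Proof.
move=> mB mF F0.
have mTB : measurable ([set: R] `*` B) by exact: measurableX.
have mF' : measurable_fun setT (F \_ ([set: R] `*` B)).
  by apply/(measurable_restrictT _ _).1 => //; exact: measurable_funTS.
have F'0 z : (0 <= (F \_ ([set: R] `*` B)) z)%E by apply: erestrict_ge0.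
have : measurable_fun setT (fubini_F mu (F \_ ([set: R] `*` B))).
  exact: measurable_fun_fubini_tonelli_F.
congr measurable_fun; apply/funext => x.
rewrite [RHS]integral_mkcond; apply: eq_integral => y _.
rewrite /patch; congr (if _ then _ else _).
by rewrite in_setX in_setT.
Qed.

Lemma ge0_integral_swap (A B : set R) (F : R * R -> \bar R) :
  measurable A -> measurable B ->
  measurable_fun setT F -> (forall z, (0 <= F z)%E) ->
  (\int[mu]_(x in A) \int[mu]_(y in B) F (x, y) =
   \int[mu]_(y in B) \int[mu]_(x in A) F (x, y))%E.
Proof.
move=> mA mB mF F0; rewrite -ge0_integral_setX//.
have mAB : measurable (A `*` B) by exact: measurableX.
rewrite integral_mkcond fubini_tonelli2; last 2 first.
- by apply/(measurable_restrictT _ _).1 => //; exact: measurable_funTS.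
- by move=> z; apply: erestrict_ge0.
rewrite [RHS]integral_mkcond; apply: eq_integral => y _.
rewrite /fubini_G /patch; case: ifPn => yB.
- rewrite [RHS]integral_mkcond; apply: eq_integral => x _.
  rewrite /patch; congr (if _ then _ else _).
  by rewrite in_setX yB andbT.
- apply: integral0_eq => x _; rewrite ifF//.
  by rewrite in_setX (negbTE yB) andbF.
Qed.

End Tonelli.

(** * Integrals of powers *)

Section Powers.
Context {R : realType}.
Notation mu := (@lebesgue_measure R).

Lemma cvg_powR_div (r q : R) : 0 < r -> 0 < q ->
  (r / n.+2%:R) `^ q @[n --> \oo] --> (0 : R).
Proof.
move=> r0 q0; have /cvg_at_rightP := powR_cvg0 q0.
apply; split; first by move=> n; rewrite divr_gt0.
rewrite -(mulr0 r); apply: cvgMr.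
have := @cvg_harmonic R.
by rewrite -(cvg_shiftn 1)/=; under eq_fun do rewrite addn1.
Qed.

Lemma integral_powR_itv (p a b : R) : -1 < p -> 0 < a -> a < b ->
  (\int[mu]_(t in `[a, b]) (t `^ p)%:E =
    (b `^ (p + 1) / (p + 1) - a `^ (p + 1) / (p + 1))%:E)%E.
Proof.
move=> p1 a0 ab.
have p10 : 0 < p + 1 by lra.
pose F (t : R) := t `^ (p + 1) / (p + 1).
have dF (t : R) : 0 < t -> is_derive t 1 F (t `^ p).
  move=> t0; rewrite /F.
  have -> : t `^ p = (p + 1)^-1 *: ((p + 1) * t `^ (p + 1 - 1)).
    by rewrite addrK /GRing.scale/= mulKf// gt_eqF.
  have -> : (fun t : R => t `^ (p + 1) / (p + 1)) = (p + 1)^-1 *: (@powR R ^~ (p + 1)).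
    by apply/funext => x /=; rewrite mulrC.
  by apply: is_deriveZ; exact: is_derive1_powR.
have cF (t : R) : 0 < t -> {for t, continuous F}.
  by move=> t0; apply/differentiable_continuous/derivable1_diffP; case: (dF t t0).
have cp (t : R) : 0 < t -> {for t, continuous (@powR R ^~ p)}.
  by move=> t0; apply/differentiable_continuous/derivable1_diffP; case: (is_derive1_powR p t0).
rewrite (@continuous_FTC2 _ _ F)//.
- apply: continuous_in_subspaceT => t /[!inE]/=; rewrite in_itv/= => /andP[at_ _].
  by apply: cp; exact: lt_le_trans at_.
- split.
  + move=> t; rewrite in_itv/= => /andP[at_ _]; by case: (dF t (lt_trans a0 at_)).
  + by apply: cvg_at_right_filter; exact: cF.
  + by apply: cvg_at_left_filter; apply: cF; exact: lt_trans ab.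
- move=> t; rewrite in_itv/= => /andP[at_ _].
  by rewrite derive1E; case: (dF t (lt_trans a0 at_)).
Qed.

(** For negative [p] the integrand is unbounded at 0, so the integral is the
    monotone limit of its values on [r / (n + 2), r]. *)
Lemma integral_powR (p r : R) : -1 < p -> 0 < r ->
  (\int[mu]_(t in `[0%R, r]) (t `^ p)%:E = (r `^ (p + 1) / (p + 1))%:E)%E.
Proof.
move=> p1 r0.
have p10 : 0 < p + 1 by lra.
have mp (D : set R) : measurable_fun D (fun t : R => (t `^ p)%:E).
  by apply/measurable_EFinP; apply: measurable_funTS; exact: measurable_powR.
rewrite -integral_itv_obnd_cbnd//.
(* [n + 2] rather than [n + 1] keeps every interval nondegenerate *)
pose F n : set R := `[r / n.+2%:R, r]%classic.
have -> : `]0, r]%classic = \bigcup_n F n.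
  apply/seteqP; split => [x|x [n _]]; rewrite /F /= !in_itv/=; last first.
    by move=> /andP[nx ->]; rewrite (lt_le_trans _ nx)// divr_gt0.
  move=> /andP[x0 xr]; exists (Num.trunc (r / x)) => //=; rewrite in_itv/= xr andbT.
  rewrite ler_pdivrMr// mulrC -ler_pdivrMr//.
  by rewrite (le_trans (ltW (truncnS_gt _)))// ler_nat.
have ndF : nondecreasing_seq F.
  apply/nondecreasing_seqP => n; apply/subsetPset => x; rewrite /F/= !in_itv/=.
  move=> /andP[nx ->]; rewrite (le_trans _ nx)// ler_pM2l// lef_pV2 ?posrE//.
  by rewrite ler_nat.
have h : (\int[mu]_(x in F i) (x `^ p)%:E @[i --> \oo] -->
   \int[mu]_(x in \bigcup_i F i) (x `^ p)%:E)%E.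
  apply: ge0_nondecreasing_set_cvg_integral => //.
    by move=> i; exact: measurable_itv.
    by move=> i; exact: mp.
  by move=> i x _; rewrite lee_fin powR_ge0.
apply: (cvg_unique (@ereal_hausdorff R) h).
apply: (@cvg_trans _ ((EFin \o
   (fun i : nat => r `^ (p + 1) / (p + 1) - (r / i.+2%:R) `^ (p + 1) / (p + 1))) @ \oo)).
  apply: near_eq_cvg; apply: nearW => n /=; rewrite integral_powR_itv//= ?divr_gt0//.
  by rewrite ltr_pdivrMr// ltr_pMr// ltr1n.
apply: cvg_EFin; first exact: nearW.
rewrite -[X in _ --> X]subr0; apply: cvgB; first exact: cvg_cst.
rewrite -(mul0r (p + 1)^-1); apply: cvgMl; exact: cvg_powR_div.
Qed.
End Powers.

(** * Powers of the distance to finitely many nodes *)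

Section NodeFun.
Context {R : realType}.
Notation mu := (@lebesgue_measure R).

(** Each of [x / (x + y)] and [y / (x + y)] is in the unit interval, where
    [z <= z `^ a]; their sum is 1. *)
Lemma powR_subadd (a x y : R) : 0 < a <= 1 -> 0 <= x -> 0 <= y ->
  (x + y) `^ a <= x `^ a + y `^ a.
Proof.
move=> /andP[a0 a1]; rewrite le_eqVlt => /predU1P[<- y0|x0].
  by rewrite add0r powR0 ?gt_eqF// add0r.
move=> y0; have s0 : 0 < x + y by lra.
have key z : 0 < z -> z <= x + y -> z / (x + y) * (x + y) `^ a <= z `^ a.
  move=> z0 zs.
  have -> : z `^ a = (z / (x + y)) `^ a * (x + y) `^ a.
    rewrite -powRM ?divfK ?gt_eqF//; last exact: ltW.
    by rewrite divr_ge0// ltW.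
  rewrite ler_wpM2r ?powR_ge0// ger1_powR// divr_gt0//=.
  by rewrite ler_pdivrMr// mul1r.
move: y0; rewrite le_eqVlt => /predU1P[<-|y0].
  by rewrite addr0 lerDl powR_ge0.
have -> : (x + y) `^ a = x / (x + y) * (x + y) `^ a + y / (x + y) * (x + y) `^ a.
  by rewrite -mulrDl -mulrDl divff ?mul1r// gt_eqF.
by apply: lerD; apply: key => //; lra.
Qed.

Lemma ler_dist_powR (a x y : R) : 0 < a <= 1 ->
  `| `|x| `^ a - `|y| `^ a | <= `|x - y| `^ a.
Proof.
move=> a01; have /andP[a0 _] := a01.
have half u v : `|u| `^ a - `|v| `^ a <= `|u - v| `^ a.
  rewrite lerBlDl; apply: le_trans (powR_subadd a01 (normr_ge0 _) (normr_ge0 _)).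
  rewrite ge0_ler_powR ?nnegrE ?(ltW a0)//= ?addr_ge0//.
  by rewrite -{1}(subrK v u) addrC ler_normD.
by rewrite ler_norml half andbT lerNl opprB distrC half.
Qed.

Lemma measurable_dist_powR (a c : R) : measurable_fun setT (fun t : R => `|t - c| `^ a).
Proof.
apply: (measurableT_comp (@measurable_powR R a)).
by apply: measurableT_comp => //; exact: measurable_funB.
Qed.

Lemma integral_dist_powR (p c r : R) : -1 < p -> 0 < r ->
  (\int[mu]_(t in `[(c - r)%R, (c + r)%R]) (`|t - c| `^ p)%:E =
    (2 * (r `^ (p + 1) / (p + 1)))%:E)%E.
Proof.
move=> p1 r0.
have mf : measurable_fun setT (fun t : R => (`|t| `^ p)%:E).
  apply/measurable_EFinP; apply: (measurableT_comp (@measurable_powR R p)).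
  exact: normr_measurable.
have f0 (t : R) : (0 <= (`|t| `^ p)%:E)%E by rewrite lee_fin powR_ge0.
rewrite (ge0_integral_itv_shift _ _ (- c) mf f0).
have -> : c - r - c = - r by lra.
have -> : c + r - c = r by lra.
rewrite (@ge0_integral_itv_split _ _ 0)//; [|lra|lra].
have E : (\int[mu]_(t in `[0%R, r]) (`|t| `^ p)%:E = (r `^ (p + 1) / (p + 1))%:E)%E.
  transitivity (\int[mu]_(t in `[0%R, r]) (t `^ p)%:E)%E; last exact: integral_powR.
  apply: eq_integral => t /[!inE]/=.
  by rewrite in_itv/= => /andP[t0 _]; rewrite ger0_norm.
have -> : (\int[mu]_(t in `[(- r)%R, 0%R]) (`|t| `^ p)%:E =
    \int[mu]_(t in `[0%R, r]) (`|t| `^ p)%:E)%E.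
  transitivity (\int[mu]_(t in `[(- r)%R, 0%R]) (`|(- t)%R| `^ p)%:E)%E.
    by apply: eq_integral => t _; rewrite normrN.
  by rewrite (ge0_integral_itv_opp _ _ mf f0) oppr0 opprK.
by rewrite E -EFinD; congr EFin; lra.
Qed.

(** The cap [M] serves as the neutral element of the minimum; the useful value
    is [M = r `^ a], which makes every node responsible only for the points at
    distance less than [r]. *)
Definition node_gauge (a M : R) (n : nat) (x : 'I_n -> R) (t : R) : R :=
  \big[Order.min/M]_(i < n) `|t - x i| `^ a.

Lemma node_gauge_ge0 a M n (x : 'I_n -> R) t : 0 <= M -> 0 <= node_gauge a M x t.
Proof.
move=> M0; rewrite /node_gauge; elim/big_ind : _ => //.
by move=> u v u0 v0; rewrite le_min u0.
Qed.

Lemma node_gauge_le_dist a M n (x : 'I_n -> R) t i : node_gauge a M x t <= `|t - x i| `^ a.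
Proof.
by rewrite /node_gauge (bigD1 i)//= ge_min lexx.
Qed.

Lemma node_gauge_node a M n (x : 'I_n -> R) i : 0 < a -> 0 <= M ->
  node_gauge a M x (x i) = 0.
Proof.
move=> a0 M0; apply/eqP; rewrite eq_le node_gauge_ge0// andbT.
by rewrite (le_trans (node_gauge_le_dist _ _ _ _ i))// subrr normr0 powR0 ?gt_eqF.
Qed.

Lemma node_gauge_holder a M n (x : 'I_n -> R) s t : 0 < a <= 1 ->
  `|node_gauge a M x s - node_gauge a M x t| <= `|s - t| `^ a.
Proof.
move=> a01; rewrite /node_gauge.
elim/big_ind2 : _ => [|u v u' v' huv hu'v'|i _].
- by rewrite subrr normr0 powR_ge0.
- rewrite ler_norml; move: huv hu'v'; rewrite !ler_norml => /andP[? ?] /andP[? ?].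
  by rewrite /Order.min; do 2!case: ifP; rewrite ?ltNge; move=> *; lra.
- by rewrite (le_trans (ler_dist_powR _ _ a01))// opprB addrA subrK.
Qed.

Lemma measurable_node_gauge a M n (x : 'I_n -> R) :
  measurable_fun setT (node_gauge a M x).
Proof.
rewrite /node_gauge; elim: (index_enum _) => [|i s IH].
  under eq_fun do rewrite big_nil. exact: measurable_cst.
under eq_fun do rewrite big_cons; apply: measurable_minr => //.
exact: measurable_dist_powR.
Qed.

(** On the support of the bump, its integral and that of [|t - c|^a] add up to
    that of the constant [r `^ a]. *)
Lemma integral_bump (a c r : R) : 0 < a -> 0 < r ->
  (\int[mu]_t (Num.max (r `^ a - `|t - c| `^ a) 0)%:E =
    (2 * (a * r `^ (a + 1) / (a + 1)))%:E)%E.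
Proof.
move=> a0 r0; pose h t := Num.max (r `^ a - `|t - c| `^ a) 0.
have mh : measurable_fun setT (fun t => (h t)%:E).
  apply/measurable_EFinP; apply: measurable_maxr => //.
  by apply: measurable_funB => //; exact: measurable_dist_powR.
have h0 t : (0 <= (h t)%:E)%E by rewrite lee_fin /h le_max lexx orbT.
have hI t : t \in `[c - r, c + r] -> h t = r `^ a - `|t - c| `^ a.
  rewrite in_itv/= => /andP[t1 t2]; rewrite /h max_l// subr_ge0.
  by rewrite ge0_ler_powR ?nnegrE ?(ltW a0) ?(ltW r0)//= ler_norml; lra.
have -> : (\int[mu]_t (h t)%:E = \int[mu]_(t in `[(c - r)%R, (c + r)%R]) (h t)%:E)%E.
  rewrite [RHS]integral_mkcond; apply: eq_integral => t _.
  rewrite patchE; case: ifPn => //; rewrite notin_setE/= in_itv/= => tI.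
  congr EFin; rewrite /h max_r// subr_le0.
  rewrite ge0_ler_powR ?nnegrE ?(ltW a0) ?(ltW r0)//=.
  by rewrite leNgt; apply/negP => /ltr_normlP[? ?]; apply: tI; apply/andP; split; lra.
have E : ((2 * r * r `^ a)%:E =
    \int[mu]_(t in `[(c - r)%R, (c + r)%R]) (h t)%:E +
    (2 * (r `^ (a + 1) / (a + 1)))%:E)%E.
  rewrite -(integral_dist_powR c)//; last lra.
  rewrite -ge0_integralD//=; last 2 first.
  - exact: measurable_funTS.
  - by apply: measurable_funTS; apply/measurable_EFinP; exact: measurable_dist_powR.
  transitivity (\int[mu]_(t in `[(c - r)%R, (c + r)%R]) (r `^ a)%:E)%E.
    rewrite integral_cst//= lebesgue_measure_itv/= lte_fin ifT; last lra.
    by rewrite -EFinB -EFinM; congr EFin; lra.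
  apply: eq_integral => t /[!inE]/= tI; rewrite -EFinD; congr EFin.
  by rewrite hI// subrK.
move: E; case: (integral _ _ _) => [v|//|//] /= [] E.
congr EFin; have -> : v = 2 * r * r `^ a - 2 * (r `^ (a + 1) / (a + 1)) by lra.
have -> : r `^ (a + 1) = r * r `^ a.
  by rewrite powRD ?(gt_eqF r0) ?implybT// powRr1 ?(ltW r0)// mulrC.
by field; lra.
Qed.


(** The deficit [r `^ a - node_gauge] is at most the sum of the bumps around the
    nodes.  The radius [r] makes the bound sharp: [n] disjoint balls of radius
    [r] fill an interval of length [2 r n]. *)
Lemma integral_node_gauge_ge (a L r : R) n (x : 'I_n -> R) :
  0 < a -> 0 < r -> L = 2 * r * n%:R ->
  ((L * r `^ a / (a + 1))%:E <=
    \int[mu]_(t in `[0%R, L]) (node_gauge a (r `^ a) x t)%:E)%E.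
Proof.
move=> a0 r0 LE.
have L0 : 0 <= L by rewrite LE !mulr_ge0// ltW.
pose h i t := Num.max (r `^ a - `|t - x i| `^ a) 0.
have mh i : measurable_fun setT (fun t => (h i t)%:E).
  apply/measurable_EFinP; apply: measurable_maxr => //.
  by apply: measurable_funB => //; exact: measurable_dist_powR.
have h0 i t : (0 <= (h i t)%:E)%E by rewrite lee_fin /h le_max lexx orbT.
have mg : measurable_fun setT (fun t => (node_gauge a (r `^ a) x t)%:E).
  by apply/measurable_EFinP; exact: measurable_node_gauge.
have g0 t : (0 <= (node_gauge a (r `^ a) x t)%:E)%E.
  by rewrite lee_fin node_gauge_ge0 ?powR_ge0.
(* at each [t] the minimum is the cap or attained at a single node *)
have cover t : r `^ a <= node_gauge a (r `^ a) x t + \sum_(i < n) h i t.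
  have hp i : 0 <= h i t by have := h0 i t; rewrite lee_fin.
  have S0 : 0 <= \sum_(i < n) h i t by apply: sumr_ge0.
  rewrite -lerBlDr; move: S0; set S := \sum_(i < n) _ => S0.
  have hS i : r `^ a - `|t - x i| `^ a <= S.
    rewrite /S (bigD1 i)//= -[leLHS]addr0 lerD ?sumr_ge0//.
    by rewrite /h le_max lexx.
  apply: (big_ind (fun z => r `^ a - S <= z)) => [|u v hu hv|i _].
  - by rewrite gerBl.
  - by rewrite le_min hu.
  - by have := hS i; lra.
have : ((L * r `^ a)%:E <= \int[mu]_(t in `[0%R, L]) (node_gauge a (r `^ a) x t)%:E
    + (n%:R * (2 * (a * r `^ (a + 1) / (a + 1))))%:E)%E.
  apply: (@le_trans _ _ (\int[mu]_(t in `[0%R, L])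
      ((node_gauge a (r `^ a) x t)%:E + \sum_(i < n) (h i t)%:E))%E).
    apply: (@le_trans _ _ (\int[mu]_(t in `[0%R, L]) (r `^ a)%:E)%E).
      rewrite integral_cst//= lebesgue_measure_itv/= lte_fin.
      case: ltP => L0'; first by rewrite -EFinB subr0 -EFinM mulrC.
      by rewrite (_ : L = 0) ?mul0r ?mule0//; lra.
    apply: ge0_le_integral => //=.
    - by move=> t _; rewrite lee_fin powR_ge0.
    - apply: measurable_funTS; apply: emeasurable_funD => //.
      by apply: emeasurable_sum.
    - by move=> t _; rewrite sumEFin -EFinD lee_fin.
  rewrite ge0_integralD//=; last 3 first.
  - exact: measurable_funTS.
  - by move=> t _; apply: sume_ge0.
  - by apply: measurable_funTS; apply: emeasurable_sum.
  rewrite leeD2l// ge0_integral_sum//=; last first.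
    by move=> i; apply: measurable_funTS; exact: mh.
  apply: (@le_trans _ _ (\sum_(i < n) (2 * (a * r `^ (a + 1) / (a + 1)))%:E)%E).
    apply: lee_sum => i _; rewrite -(integral_bump (x i) a0 r0).
    apply: ge0_subset_integral => //; first exact: mh.
  rewrite sumEFin lee_fin sumr_const card_ord -mulr_natl; lra.
case: (integral _ _ _) => [v|_|] //=; last by rewrite leey.
rewrite -EFinD !lee_fin; have -> : r `^ (a + 1) = r * r `^ a.
  by rewrite powRD ?(gt_eqF r0) ?implybT// powRr1 ?(ltW r0)// mulrC.
move=> H; rewrite ler_pdivrMr; last lra.
have a1 : a + 1 != 0 by rewrite gt_eqF//; lra.
have E : n%:R * (2 * (a * (r * r `^ a) / (a + 1))) * (a + 1) = L * a * r `^ a.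
  by rewrite LE; field.
have : (L * r `^ a) * (a + 1) <=
    (v + n%:R * (2 * (a * (r * r `^ a) / (a + 1)))) * (a + 1).
  by rewrite ler_wpM2r//; lra.
by rewrite mulrDl E; lra.
Qed.

End NodeFun.

(** * The kernel and its regularisations *)

Section Kernel.
Context {R : realType}.
Implicit Types (l d t u v : R) (z : R * R).

(** The kernel as a function of [z = sigma - s], with [d] added to the base of
    the power; [d = 0] is the singular kernel itself. *)
Definition reg_kernel l d z : R :=
  ((sin (z.1 / 2) ^+ 2 + sin (z.2 / 2) ^+ 2 + d) `^ l)^-1.

Lemma reg_kernel_ge0 l d z : 0 <= reg_kernel l d z.
Proof. by rewrite invr_ge0 powR_ge0. Qed.

Lemma singular_kernelE l (s z : R * R) :
  singular_kernel l z s = reg_kernel l 0 (z.1 - s.1, z.2 - s.2).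
Proof. by rewrite /singular_kernel /reg_kernel addr0. Qed.

Lemma measurable_reg_kernel l d : measurable_fun setT (reg_kernel l d).
Proof.
have msin : measurable_fun setT (fun x : R => sin (x / 2) ^+ 2).
  apply: measurable_funX; apply: measurableT_comp; last exact: mulrr_measurable.
  apply: continuous_measurable_fun. exact: continuous_sin.
have -> : reg_kernel l d = (fun x : R => x `^ (- l)) \o
    (fun z => sin (z.1 / 2) ^+ 2 + sin (z.2 / 2) ^+ 2 + d).
  by apply/funext => z /=; rewrite powRN.
apply: measurableT_comp; first exact: measurable_powR.
apply: measurable_funD => //; apply: measurable_funD.
- exact: (measurableT_comp msin measurable_fst).
- exact: (measurableT_comp msin measurable_snd).
Qed.

Lemma sin_half_sqr_periodic t : sin ((t + 2 * pi) / 2) ^+ 2 = sin (t / 2) ^+ 2.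
Proof.
have -> : (t + 2 * pi) / 2 = t / 2 + pi by lra.
by rewrite sinDpi sqrrN.
Qed.

Lemma reg_kernel_periodicl l d u v : reg_kernel l d (u + 2 * pi, v) = reg_kernel l d (u, v).
Proof. by rewrite /reg_kernel/= sin_half_sqr_periodic. Qed.

Lemma reg_kernel_periodicr l d u v : reg_kernel l d (u, v + 2 * pi) = reg_kernel l d (u, v).
Proof. by rewrite /reg_kernel/= sin_half_sqr_periodic. Qed.

Lemma reg_kernelN l d u v : reg_kernel l d (- u, v) = reg_kernel l d (u, v).
Proof. by rewrite /reg_kernel/= mulNr sinN sqrrN. Qed.

Lemma reg_kernelC l d u v : reg_kernel l d (u, v) = reg_kernel l d (v, u).
Proof. by rewrite /reg_kernel/= (addrC (sin (u / 2) ^+ 2)). Qed.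

Lemma sin_half_sqrE (x : R) : sin (x / 2) ^+ 2 = (1 - cos x) / 2.
Proof.
have -> : cos x = cos ((x / 2) *+ 2) by congr cos; rewrite mulr2n; lra.
have := cos2Dsin2 (x / 2); rewrite cos_mulr2n; lra.
Qed.

Lemma sin_half_sqr_lipschitz u v :
  sin (u / 2) ^+ 2 <= sin (v / 2) ^+ 2 + `|u - v|.
Proof.
suff : `|cos u - cos v| <= `|u - v|.
  rewrite !sin_half_sqrE => /ler_normlP[]; have := normr_ge0 (u - v); lra.
wlog uv : u v / u <= v => [H|].
  have [/H//|/ltW/H] := leP u v; by rewrite distrC (distrC v).
rewrite distrC (distrC u).
have [c _ ->] := @MVT_segment R cos (fun x => - sin x) u v uv
  (fun x _ => is_derive_cos x) (continuous_subspaceT (@continuous_cos R)).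
by rewrite normrM normrN -[leRHS]mul1r ler_wpM2r// sin_max.
Qed.

(** The base is Lipschitz and at least [d], so its values at two points have
    ratio at most [1 + |u - t| / d], and an exponent at most 1 does not increase
    this ratio.  A bound on the ratio, unlike one on the difference, keeps its
    form under integration in the second variable. *)
Lemma reg_kernel_harnack l d t u v : 0 <= l <= 1 -> 0 < d ->
  reg_kernel l d (t, v) <= (1 + `|u - t| / d) * reg_kernel l d (u, v).
Proof.
move=> /andP[l0 l1] d0; rewrite /reg_kernel/=.
set wt := sin (t / 2) ^+ 2; set wu := sin (u / 2) ^+ 2; set wv := sin (v / 2) ^+ 2.
have [wt0 wu0 wv0] : [/\ 0 <= wt, 0 <= wu & 0 <= wv] by rewrite !sqr_ge0.
have wut : wu <= wt + `|u - t| by exact: sin_half_sqr_lipschitz.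
have At : 0 < wt + wv + d by lra.
have Au : 0 < wu + wv + d by lra.
have n0 := normr_ge0 (u - t).
have c1 : 1 <= 1 + `|u - t| / d by rewrite lerDl divr_ge0// ltW.
have AuAt : wu + wv + d <= (1 + `|u - t| / d) * (wt + wv + d).
  rewrite mulrDl mul1r -lerBlDl; apply: (@le_trans _ _ `|u - t|); first lra.
  rewrite mulrAC ler_pdivlMr// ler_wpM2l//; lra.
rewrite -[leLHS]mul1r ler_pdivrMr ?powR_gt0// mulrAC ler_pdivlMr ?powR_gt0// mul1r.
apply: (@le_trans _ _ (((1 + `|u - t| / d) * (wt + wv + d)) `^ l)).
  by rewrite ge0_ler_powR// nnegrE ?mulr_ge0// ltW// (lt_le_trans _ c1).
rewrite powRM ?(ltW At)//; last exact: le_trans c1.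
by rewrite ler_wpM2r ?powR_ge0// ler1_powR.
Qed.

Lemma powR_invl (x q : R) : 0 <= x -> x^-1 `^ q = (x `^ q)^-1.
Proof. by move=> x0; rewrite -powR_inv1// -powRrM mulN1r powRN. Qed.

(** With [w] the base, [1 = w / (w + d) + d / (w + d)], where the first term is
    at most [(w / (w + d)) `^ l] and the second at most [(d / w) `^ q].  So the
    price of the regularisation is a power of [d] times a kernel that is only
    slightly more singular, whose mass is still finite when [l + q < 1]. *)
Lemma reg_kernel_split l d q z : 0 < l <= 1 -> 0 < d -> 0 <= q <= 1 ->
  reg_kernel l 0 z <= reg_kernel l d z + d `^ q * reg_kernel (l + q) 0 z.
Proof.
move=> /andP[l0 l1] d0 /andP[q0 q1]; rewrite /reg_kernel addr0.
set w := sin (z.1 / 2) ^+ 2 + sin (z.2 / 2) ^+ 2.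
have : 0 <= w by rewrite addr_ge0// sqr_ge0.
rewrite le_eqVlt => /predU1P[<-|w0].
  (* at the singularity the left-hand side is 0 by convention *)
  rewrite powR0 ?gt_eqF// invr0 addr_ge0 ?mulr_ge0 ?invr_ge0 ?powR_ge0//.
have wd0 : 0 < w + d by lra.
rewrite powRD; last by rewrite (gt_eqF w0) implybT.
rewrite invfM (mulrCA (d `^ q)) -[d `^ q / _]/(d `^ q / w `^ q).
have -> : d `^ q / w `^ q = (d / w) `^ q.
  by rewrite powRM ?invr_ge0 ?(ltW d0) ?(ltW w0)// powR_invl// ltW.
have step1 : w / (w + d) <= (w / (w + d)) `^ l.
  by rewrite ger1_powR ?divr_gt0//= ler_pdivrMr// mul1r; lra.
have step2 : d / (w + d) <= (d / w) `^ q.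
  apply: (@le_trans _ _ ((d / (w + d)) `^ q)).
    by rewrite ger1_powR ?divr_gt0//= ler_pdivrMr// mul1r; lra.
  rewrite ge0_ler_powR// ?nnegrE ?divr_ge0// ?(ltW d0) ?(ltW w0) ?(ltW wd0)//.
  by rewrite ler_wpM2l ?(ltW d0)// lef_pV2 ?posrE//; lra.
have E : ((w + d) `^ l)^-1 = (w `^ l)^-1 * (w / (w + d)) `^ l.
  rewrite powRM ?invr_ge0 ?(ltW w0) ?(ltW wd0)// mulrA mulVf ?mul1r; last first.
    by rewrite gt_eqF ?powR_gt0.
  by rewrite powR_invl// ltW.
rewrite E -mulrDr -[leLHS]mulr1 ler_wpM2l ?invr_ge0 ?powR_ge0//.
have : w / (w + d) + d / (w + d) = 1 by rewrite -mulrDl divff ?gt_eqF.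
lra.
Qed.

End Kernel.

(** * The kernel integrated in one variable *)

Section Profile.
Context {R : realType}.
Notation mu := (@lebesgue_measure R).
Notation I := (`[0%R, (2 * pi)%R]%classic : set R).
Implicit Types (l d t u v s : R) (z : R * R).

(** An extended real: for [d = 0], [l >= 1/2] and [u] in the period lattice it is
    infinite. *)
Definition profile l d u : \bar R := (\int[mu]_(v in I) (reg_kernel l d (u, v))%:E)%E.

Definition total_mass l d : \bar R := (\int[mu]_(u in I) profile l d u)%E.

Lemma profile_ge0 l d u : (0 <= profile l d u)%E.
Proof. by apply: integral_ge0 => v _; rewrite lee_fin reg_kernel_ge0. Qed.

Lemma measurable_profile l d : measurable_fun setT (profile l d).
Proof.
apply: (@ge0_measurable_integralr _ I (fun z => (reg_kernel l d z)%:E)) => //.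
- by apply/measurable_EFinP; exact: measurable_reg_kernel.
- by move=> z; rewrite lee_fin reg_kernel_ge0.
Qed.

Lemma profile_periodic l d u : profile l d (u + 2 * pi) = profile l d u.
Proof. by apply: eq_integral => v _; rewrite reg_kernel_periodicl. Qed.

Lemma profileN l d u : profile l d (- u) = profile l d u.
Proof. by apply: eq_integral => v _; rewrite reg_kernelN. Qed.

Lemma measurable_reg_kernelr l d u :
  measurable_fun setT (fun v => (reg_kernel l d (u, v))%:E).
Proof.
apply/measurable_EFinP.
exact: (measurableT_comp (measurable_reg_kernel l d) (pair1_measurable u)).
Qed.

Lemma integral_reg_kernel_shift l d u s : 0 <= s <= 2 * pi ->
  (\int[mu]_(v in I) (reg_kernel l d (u, (v - s)%R))%:E)%E = profile l d u.
Proof.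
move=> sI; apply: (ge0_integral_periodic_shift (f := fun v => (reg_kernel l d (u, v))%:E) sI).
- exact: measurable_reg_kernelr.
- by move=> v; rewrite lee_fin reg_kernel_ge0.
- by move=> v; rewrite reg_kernel_periodicr.
Qed.

Lemma integral_profile_shift l d s : 0 <= s <= 2 * pi ->
  (\int[mu]_(t in I) profile l d (t - s)%R)%E = total_mass l d.
Proof.
move=> sI; apply: (ge0_integral_periodic_shift sI).
- exact: measurable_profile.
- exact: profile_ge0.
- exact: profile_periodic.
Qed.

(** The profile is even, so it may also be integrated over the centre of the
    translation. *)
Lemma integral_profile_shift_center l d t : 0 <= t <= 2 * pi ->
  (\int[mu]_(s in I) profile l d (t - s)%R)%E = total_mass l d.
Proof.
move=> tI; rewrite -(integral_profile_shift _ _ tI).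
by apply: eq_integral => s _; rewrite -profileN opprB.
Qed.

Lemma total_massE l d :
  total_mass l d = (\int[leb2 R]_(z in square R) (reg_kernel l d z)%:E)%E.
Proof.
rewrite /square ge0_integral_setX//.
- by apply/measurable_EFinP; exact: measurable_reg_kernel.
- by move=> z; rewrite lee_fin reg_kernel_ge0.
Qed.

Lemma profile_harnack l d t u : 0 <= l <= 1 -> 0 < d ->
  (profile l d t <= (1 + `|u - t| / d)%:E * profile l d u)%E.
Proof.
move=> l01 d0.
have c0 : 0 <= 1 + `|u - t| / d by rewrite addr_ge0// divr_ge0// ltW.
rewrite -ge0_integralZl//=; last 2 first.
- by apply: measurable_funTS; exact: measurable_reg_kernelr.
- by move=> v _; rewrite lee_fin reg_kernel_ge0.
apply: ge0_le_integral => //=.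
- by move=> v _; rewrite lee_fin reg_kernel_ge0.
- by apply: measurable_funTS; exact: measurable_reg_kernelr.
- by apply: measurable_funTS; apply: measurable_funeM; exact: measurable_reg_kernelr.
- by move=> v _; rewrite -EFinM lee_fin reg_kernel_harnack.
Qed.

Lemma profile_split l d q u : 0 < l <= 1 -> 0 < d -> 0 <= q <= 1 ->
  (profile l 0 u <= profile l d u + (d `^ q)%:E * profile (l + q) 0 u)%E.
Proof.
move=> l01 d0 q01.
rewrite -ge0_integralZl//=; last 3 first.
- by apply: measurable_funTS; exact: measurable_reg_kernelr.
- by move=> v _; rewrite lee_fin reg_kernel_ge0.
- by rewrite lee_fin powR_ge0.
rewrite -ge0_integralD//=; last 4 first.
- by move=> v _; rewrite lee_fin reg_kernel_ge0.
- by apply: measurable_funTS; exact: measurable_reg_kernelr.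
- by move=> v _; rewrite -EFinM lee_fin mulr_ge0 ?reg_kernel_ge0 ?powR_ge0.
- by apply: measurable_funTS; apply: measurable_funeM; exact: measurable_reg_kernelr.
apply: ge0_le_integral => //=.
- by move=> v _; rewrite lee_fin reg_kernel_ge0.
- by apply: measurable_funTS; exact: measurable_reg_kernelr.
- apply: measurable_funTS; apply: emeasurable_funD; first exact: measurable_reg_kernelr.
  by apply: measurable_funeM; exact: measurable_reg_kernelr.
- by move=> v _; rewrite -EFinM -EFinD lee_fin reg_kernel_split.
Qed.

Notation J := (`]0%R, (2 * pi)%R[%classic : set R).

Lemma sin_half_gt0 u : J u -> 0 < sin (u / 2).
Proof.
rewrite /= in_itv/= => /andP[u0 u1]; apply: sin_gt0_pi; apply/andP; split; lra.
Qed.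

Lemma total_mass_open l d : total_mass l d =
  (\int[mu]_(u in J) \int[mu]_(v in J) (reg_kernel l d (u, v))%:E)%E.
Proof.
rewrite /total_mass integral_itv_bndoo; last first.
  by apply: measurable_funTS; exact: measurable_profile.
apply: eq_integral => u _; rewrite /profile integral_itv_bndoo//.
by apply: measurable_funTS; exact: measurable_reg_kernelr.
Qed.

(** Where the base vanishes and [l > 0], the singular kernel is 0 and the
    comparison of the kernels fails; the open interval avoids these points. *)
Lemma total_mass_le l d : 0 <= l -> 0 <= d -> (total_mass l d <= total_mass l 0)%E.
Proof.
move=> l0 d0.
have mprof d' : measurable_fun J (profile l d').
  by apply: measurable_funTS; exact: measurable_profile.
have openE d' : total_mass l d' = (\int[mu]_(u in J) profile l d' u)%E.
  by rewrite /total_mass integral_itv_bndoo.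
rewrite !openE.
apply: ge0_le_integral => //=.
- by move=> u _; exact: profile_ge0.
- by apply: measurable_funTS; exact: measurable_profile.
- by apply: measurable_funTS; exact: measurable_profile.
move=> u uJ; apply: ge0_le_integral => //=.
- by move=> v _; rewrite lee_fin reg_kernel_ge0.
- by apply: measurable_funTS; exact: measurable_reg_kernelr.
- by apply: measurable_funTS; exact: measurable_reg_kernelr.
move=> v _; rewrite lee_fin /reg_kernel/= addr0.
have w0 : 0 < sin (u / 2) ^+ 2 + sin (v / 2) ^+ 2.
  by rewrite ltr_wpDr ?sqr_ge0// exprn_gt0 ?sin_half_gt0.
rewrite lef_pV2 ?posrE ?powR_gt0//; last lra.
by rewrite ge0_ler_powR ?nnegrE//; lra.
Qed.

Lemma total_mass_gt0 l : 0 <= l <= 1 -> (0 < total_mass l 0)%E.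
Proof.
move=> /andP[l0 l1]; have pi0 := pi_gt0 R.
rewrite total_mass_open.
apply: (@lt_le_trans _ _ (\int[mu]_(u in J) \int[mu]_(v in J) (2^-1)%:E)%E).
  have muJ : mu J = (2 * pi)%:E.
    by rewrite lebesgue_measure_itv/= lte_fin ifT; [rewrite -EFinB subr0|lra].
  under eq_integral do rewrite integral_cst//= muJ -EFinM.
  by rewrite integral_cst//= muJ -EFinM lte_fin !mulr_gt0.
have half_le u v : J u -> ((2^-1)%:E <= (reg_kernel l 0 (u, v))%:E)%E.
  move=> uJ; rewrite lee_fin /reg_kernel/= addr0.
  have w0 : 0 < sin (u / 2) ^+ 2 + sin (v / 2) ^+ 2.
    by rewrite ltr_wpDr ?sqr_ge0// exprn_gt0 ?sin_half_gt0.
  have w2 : sin (u / 2) ^+ 2 + sin (v / 2) ^+ 2 <= 2.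
    have := cos2Dsin2 (u / 2); have := cos2Dsin2 (v / 2).
    by have := sqr_ge0 (cos (u / 2)); have := sqr_ge0 (cos (v / 2)); lra.
  rewrite lef_pV2 ?posrE ?powR_gt0//.
  apply: (@le_trans _ _ (2 `^ l)); last by rewrite ler1_powR// ler1n.
  by rewrite ge0_ler_powR ?nnegrE// ltW.
apply: ge0_le_integral => //=.
- by move=> u _; apply: integral_ge0 => v _; rewrite lee_fin.
- apply: measurable_funTS; apply: (@ge0_measurable_integralr _ J (fun z => (reg_kernel l 0 z)%:E)) => //.
  + by apply/measurable_EFinP; exact: measurable_reg_kernel.
  + by move=> z; rewrite lee_fin reg_kernel_ge0.
- move=> u uJ; apply: ge0_le_integral => //=.
  + by apply: measurable_funTS; exact: measurable_reg_kernelr.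
  + by move=> v _; exact: half_le.
Qed.

(** With [x = 2 v]: [sin x = 2 sin v cos v >= 2 v (cos v)^2 = v (1 + cos x)]
    and [cos x >= 0], where [sin v >= v cos v] by the mean value theorem. *)
Lemma sin_ge_half (x : R) : 0 <= x <= pi / 2 -> x / 2 <= sin x.
Proof.
move=> /andP[x0 x1]; have pi0 := pi_gt0 R.
pose v := x / 2.
have v0 : 0 <= v by rewrite /v; lra.
have [c cI] := @MVT_segment R (@sin R) (@cos R) 0 v v0
  (fun x _ => is_derive_sin x) (continuous_subspaceT (@continuous_sin R)).
rewrite sin0 !subr0 => sv.
have cv : cos v <= cos c.
  move: cI; rewrite in_itv/= => /andP[c0 c1].
  by rewrite leNgt ltr_cos -?leNgt ?in_itv/= ?c0 ?v0 //=; rewrite /v in c1 *; lra.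
have xE : x = v *+ 2 by rewrite mulr2n /v; lra.
have cx0 : 0 <= cos (v *+ 2) by rewrite -xE cos_ge0_pihalf//; apply/andP; split; lra.
have cv0 : 0 <= cos v by rewrite cos_ge0_pihalf//; rewrite /v; apply/andP; split; lra.
rewrite xE sin_mulr2n mulr2n; rewrite cos_mulr2n in cx0.
have : v * cos v ^+ 2 <= cos v * sin v.
  by rewrite sv expr2 mulrCA ler_wpM2l// mulrC ler_wpM2r.
nra.
Qed.

End Profile.

(** * Finiteness of the total mass *)

Section FiniteMass.
Context {R : realType}.
Notation mu := (@lebesgue_measure R).
Notation I := (`[0%R, (2 * pi)%R]%classic : set R).
Notation J := (`]0%R, (2 * pi)%R[%classic : set R).
Implicit Types (l d t u v s : R) (z : R * R).

Definition sin_power l u : R := (`|sin (u / 2)| `^ l)^-1.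

Lemma sin_power_ge0 l u : 0 <= sin_power l u.
Proof. by rewrite invr_ge0 powR_ge0. Qed.

Lemma measurable_sin_power l : measurable_fun setT (sin_power l).
Proof.
have -> : sin_power l = (fun x : R => x `^ (- l)) \o (fun u => `|sin (u / 2)|).
  by apply/funext => u /=; rewrite powRN.
apply: measurableT_comp; first exact: measurable_powR.
apply: measurableT_comp; first exact: normr_measurable.
apply: measurableT_comp; last exact: mulrr_measurable.
by apply: continuous_measurable_fun; exact: continuous_sin.
Qed.

Lemma sin_power_le l u : 0 < l <= 1 -> 0 <= u <= pi -> sin_power l u <= 4 * u `^ (- l).
Proof.
move=> /andP[l0 l1] /andP[]; rewrite le_eqVlt => /predU1P[<- _|u0 u1].
  by rewrite /sin_power mul0r sin0 normr0 powR0 ?gt_eqF// invr0 mulr_ge0 ?powR_ge0.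
have s4 : u / 4 <= sin (u / 2).
  have -> : u / 4 = u / 2 / 2 by lra.
  by apply: sin_ge_half; apply/andP; split; lra.
have s0 : 0 < sin (u / 2) by apply: lt_le_trans s4; lra.
rewrite /sin_power gtr0_norm// powRN.
rewrite -[4]invrK -invfM lef_pV2 ?posrE ?mulr_gt0 ?powR_gt0//.
apply: (@le_trans _ _ ((u / 4) `^ l)); last first.
  by rewrite ge0_ler_powR// ?nnegrE; lra.
rewrite mulrC powRM//; [|lra].
by rewrite ler_wpM2l ?powR_ge0// ger1_powR//; lra.
Qed.

Lemma sin_powerN l u : sin_power l (- u) = sin_power l u.
Proof. by rewrite /sin_power mulNr sinN normrN. Qed.

Lemma sin_power_periodic l u : sin_power l (u + 2 * pi) = sin_power l u.
Proof.
rewrite /sin_power; have -> : (u + 2 * pi) / 2 = u / 2 + pi by lra.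
by rewrite sinDpi normrN.
Qed.

Lemma integral_sin_power_lty l : 0 < l < 1 ->
  (\int[mu]_(u in I) (sin_power l u)%:E < +oo)%E.
Proof.
move=> /andP[l0 l1]; have pi0 := pi_gt0 R.
have mf : measurable_fun setT (fun u => (sin_power l u)%:E).
  by apply/measurable_EFinP; exact: measurable_sin_power.
have f0 u : (0 <= (sin_power l u)%:E)%E by rewrite lee_fin sin_power_ge0.
rewrite (@ge0_integral_itv_split _ _ pi)//; [|lra|lra].
have -> : (\int[mu]_(u in `[(pi : R), (2 * pi)%R]) (sin_power l u)%:E =
    \int[mu]_(u in `[0%R, (pi : R)]) (sin_power l u)%:E)%E.
  transitivity (\int[mu]_(u in `[(pi : R), (2 * pi)%R])
      (sin_power l (- u + 2 * pi)%R)%:E)%E.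
    by apply: eq_integral => u _; rewrite sin_power_periodic sin_powerN.
  have mf' : measurable_fun setT (fun u => (sin_power l (u + 2 * pi)%R)%:E).
    by apply: (measurableT_comp mf); exact: measurable_funD.
  rewrite (ge0_integral_itv_opp _ _ mf' (fun u => f0 (u + 2 * pi))).
  rewrite (ge0_integral_itv_shift _ _ _ mf f0).
  have -> : - (2 * pi) + 2 * pi = 0 :> R by lra.
  by have -> : - pi + 2 * pi = pi :> R by lra.
have fin : (\int[mu]_(u in `[0%R, (pi : R)]) (sin_power l u)%:E < +oo)%E.
  apply: (@le_lt_trans _ _ (\int[mu]_(u in `[0%R, (pi : R)]) (4 * u `^ (- l))%:E)%E).
    apply: ge0_le_integral => //=.
    - exact: measurable_funTS.
    - apply/measurable_EFinP; apply: measurable_funTS.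
      apply: measurable_funM; [exact: measurable_cst|exact: measurable_powR].
    - by move=> u; rewrite in_itv/= => uI; rewrite lee_fin sin_power_le// l0 ltW.
  under eq_integral do rewrite EFinM.
  rewrite ge0_integralZl//=; last 2 first.
  - by apply/measurable_EFinP; apply: measurable_funTS; exact: measurable_powR.
  - by move=> u _; rewrite lee_fin powR_ge0.
  by rewrite integral_powR//; [rewrite -EFinM ltry|lra].
by rewrite lte_add_pinfty.
Qed.

(** From [x^2 + y^2 >= x y]. *)
Lemma reg_kernel_le_sin_power l u v : 0 <= l -> J u -> J v ->
  reg_kernel l 0 (u, v) <= sin_power l u * sin_power l v.
Proof.
move=> l0 /sin_half_gt0 su /sin_half_gt0 sv; rewrite /reg_kernel/= addr0 /sin_power.
rewrite !gtr0_norm// -invfM -powRM ?(ltW su) ?(ltW sv)//.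
have h : sin (u / 2) * sin (v / 2) <= sin (u / 2) ^+ 2 + sin (v / 2) ^+ 2.
  move: su sv; set a := sin _; set b := sin _ => a0 b0; nra.
have ab0 : 0 < sin (u / 2) * sin (v / 2) by rewrite mulr_gt0.
rewrite lef_pV2 ?posrE ?powR_gt0//; last exact: lt_le_trans h.
by rewrite ge0_ler_powR ?nnegrE// ltW//; exact: lt_le_trans h.
Qed.

Lemma total_mass_lty l : 0 < l < 1 -> (total_mass l 0 < +oo)%E.
Proof.
move=> l01; have /andP[l0 l1] := l01.
have mS : measurable_fun setT (fun u => (sin_power l u)%:E).
  by apply/measurable_EFinP; exact: measurable_sin_power.
have S0 (u : R) : (0 <= (sin_power l u)%:E)%E by rewrite lee_fin sin_power_ge0.
set S := (\int[mu]_(u in J) (sin_power l u)%:E)%E.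
have Sfin : S \is a fin_num.
  rewrite ge0_fin_numE; last by apply: integral_ge0.
  apply: le_lt_trans (integral_sin_power_lty l01).
  by rewrite [leRHS]integral_itv_bndoo//; exact: measurable_funTS.
rewrite total_mass_open.
apply: (@le_lt_trans _ _ (\int[mu]_(u in J) (S * (sin_power l u)%:E))%E).
  apply: ge0_le_integral => //=.
  - by move=> u _; apply: integral_ge0 => v _; rewrite lee_fin reg_kernel_ge0.
  - apply: measurable_funTS; apply: (@ge0_measurable_integralr _ J (fun z => (reg_kernel l 0 z)%:E)) => //.
    + by apply/measurable_EFinP; exact: measurable_reg_kernel.
    + by move=> z; rewrite lee_fin reg_kernel_ge0.
  - by apply: measurable_funTS; exact: measurable_funeM.
  move=> u uJ; rewrite muleC -ge0_integralZl//; last first.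
    exact: measurable_funTS.
  apply: ge0_le_integral => //=.
  - by move=> v _; rewrite lee_fin reg_kernel_ge0.
  - by apply: measurable_funTS; exact: measurable_reg_kernelr.
  - by apply: measurable_funTS; exact: measurable_funeM.
  - by move=> v vJ; rewrite -EFinM lee_fin reg_kernel_le_sin_power// ltW.
rewrite ge0_integralZl//; last 2 first.
- exact: measurable_funTS.
- by apply: integral_ge0.
by rewrite -/S -(fineK Sfin) -EFinM ltry.
Qed.

End FiniteMass.

(** * Quadrature at the midpoints against a translate of the profile *)

Section GridEstimate.
Context {R : realType}.
Notation mu := (@lebesgue_measure R).

Lemma grid0 n : grid R n 0 = 0.
Proof. by rewrite /grid mulr0 !mul0r. Qed.

Lemma gridn n : (0 < n)%N -> grid R n n = 2 * pi.
Proof. by move=> n0; rewrite /grid mulrAC mulfK// pnatr_eq0 -lt0n. Qed.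

Lemma grid_midl n k : grid R n k = midpoint R n k - pi / n%:R.
Proof. by rewrite /midpoint /grid -natr1; move: n%:R^-1 => y; field. Qed.

Lemma grid_midr n k : grid R n k.+1 = midpoint R n k + pi / n%:R.
Proof. by rewrite /midpoint /grid -natr1; move: n%:R^-1 => y; field. Qed.

Lemma le_grid n : {homo grid R n : i j / (i <= j)%N >-> i <= j}.
Proof.
move=> i j ij; rewrite /grid ler_wpM2r ?invr_ge0// ler_wpM2r ?pi_ge0//.
by rewrite ler_wpM2l// ler_nat.
Qed.

Definition midpoint_gauge (a : R) n : R -> R :=
  node_gauge a ((pi / n%:R) `^ a) (fun k : 'I_n => midpoint R n k).

(** The midpoint of a cell is the nearest one to every point of the cell. *)
Lemma midpoint_gauge_ge a n (k : 'I_n) t : 0 <= a ->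
  grid R n k <= t <= grid R n k.+1 -> `|t - midpoint R n k| `^ a <= midpoint_gauge a n t.
Proof.
move=> a0; rewrite grid_midl grid_midr => /andP[t1 t2].
have n0 : (0 < n)%N := leq_ltn_trans (leq0n k) (ltn_ord k).
have r0 : 0 < pi / n%:R :> R by rewrite divr_gt0 ?pi_gt0// ltr0n.
have tk : `|t - midpoint R n k| <= pi / n%:R by rewrite ler_norml; lra.
apply: (big_ind (fun z => `|t - midpoint R n k| `^ a <= z)) => [|u v hu hv|i _].
- by rewrite ge0_ler_powR// nnegrE ltW.
- by rewrite le_min hu.
rewrite ge0_ler_powR ?nnegrE//.
have far (i' j : nat) : (i' < j)%N -> midpoint R n i' + 2 * (pi / n%:R) <= midpoint R n j.
  move=> ij; have := @le_grid n _ _ ij.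
  by rewrite (grid_midl n j) (grid_midr n i'); lra.
have [jk|kj|/val_inj<-//] := ltngtP (i : nat) k.
- have := far _ _ jk; have := ler_norm (t - midpoint R n i).
  by move=> ? ?; apply: le_trans tk _; lra.
- have := far _ _ kj; have := ler_norm (- (t - midpoint R n i)); rewrite normrN.
  by move=> ? ?; apply: le_trans tk _; lra.
Qed.

Lemma midpoint_gauge_le a n (k : 'I_n) t : midpoint_gauge a n t <= `|t - midpoint R n k| `^ a.
Proof. exact: (node_gauge_le_dist _ _ (fun k : 'I_n => midpoint R n k)). Qed.

Lemma midpoint_gauge_le_cap a n t : midpoint_gauge a n t <= (pi / n%:R) `^ a.
Proof.
rewrite /midpoint_gauge /node_gauge; elim: (index_enum _) => [|i s IH]; first by rewrite big_nil.
by rewrite big_cons ge_min IH orbT.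
Qed.

Lemma measurable_midpoint_gauge a n : measurable_fun setT (midpoint_gauge a n).
Proof. exact: measurable_node_gauge. Qed.

Lemma midpoint_gauge_ge0 a n t : 0 <= midpoint_gauge a n t.
Proof. by rewrite node_gauge_ge0 ?powR_ge0. Qed.

(** If [h] varies by a factor at most [c] on the cell, then [h] is pointwise at
    most [c] times its mean there, so up to the factor [c] the weight
    [|t - m|^a] may be replaced by its own mean [r `^ a / (a + 1)]. *)
Lemma integral_cell_harnack (a m r c : R) (h : R -> \bar R) :
  0 < a -> 0 < r -> 0 <= c ->
  measurable_fun setT h -> (forall t, (0 <= h t)%E) ->
  (forall t u, t \in `[m - r, m + r] -> u \in `[m - r, m + r] -> (h t <= c%:E * h u)%E) ->
  (\int[mu]_(t in `[(m - r)%R, (m + r)%R]) ((`|t - m| `^ a)%:E * h t) <=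
   (r `^ a * (c / (a + 1)))%:E * \int[mu]_(t in `[(m - r)%R, (m + r)%R]) h t)%E.
Proof.
move=> a0 r0 c0 mh h0 hc.
set K := `[(m - r)%R, (m + r)%R]%classic.
have mK : measurable K by exact: measurable_itv.
set H := (\int[mu]_(t in K) h t)%E.
have H0 : (0 <= H)%E by apply: integral_ge0.
(* integrate the Harnack inequality in its right-hand variable *)
have cmean t : K t -> (h t <= (c / (2 * r))%:E * H)%E.
  move=> tK.
  have : (\int[mu]_(u in K) h t <= \int[mu]_(u in K) (c%:E * h u))%E.
    apply: ge0_le_integral => //=.
    - by apply: measurable_funTS; exact: measurable_funeM.
    - by move=> u uK; exact: hc.
  rewrite ge0_integralZl//; last exact: measurable_funTS.
  have -> : (\int[mu]_(_ in K) h t = h t * (2 * r)%:E)%E.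
    have <- : mu K = (2 * r)%:E.
      rewrite lebesgue_measure_itv/= lte_fin ifT; last lra.
      by rewrite -EFinB; congr EFin; lra.
    exact: integral_cst.
  rewrite -lee_pdivlMr; last lra.
  by rewrite muleAC -EFinM muleC.
apply: (@le_trans _ _ (\int[mu]_(t in K) ((`|t - m| `^ a)%:E * ((c / (2 * r))%:E * H)))%E).
  apply: ge0_le_integral => //=.
  - by move=> t _; rewrite mule_ge0// lee_fin powR_ge0.
  - apply: measurable_funTS; apply: emeasurable_funM => //.
    by apply/measurable_EFinP; exact: measurable_dist_powR.
  - apply: measurable_funTS; apply: emeasurable_funM => //.
    by apply/measurable_EFinP; exact: measurable_dist_powR.
  - by move=> t tK; rewrite lee_wpmul2l ?lee_fin ?powR_ge0// cmean.
rewrite ge0_integralZr//; last 2 first.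
- by apply: measurable_funTS; apply/measurable_EFinP; exact: measurable_dist_powR.
- by rewrite mule_ge0// lee_fin divr_ge0// mulr_ge0// ltW.
have -> := @integral_dist_powR R a m r _ r0; last lra.
rewrite muleA -EFinM lee_wpmul2r// lee_fin.
rewrite powRD ?(gt_eqF r0) ?implybT// powRr1 ?(ltW r0)//.
rewrite le_eqVlt; apply/orP; left; apply/eqP; field.
by rewrite (gt_eqF r0) gt_eqF//; lra.
Qed.

End GridEstimate.

Section UniformEstimate.
Context {R : realType}.
Notation mu := (@lebesgue_measure R).
Notation I := (`[0%R, (2 * pi)%R]%classic : set R).

Lemma integral_subdivision_grid n (f : R -> \bar R) : (0 < n)%N ->
  measurable_fun setT f -> (forall x, (0 <= f x)%E) ->
  (\int[mu]_(x in I) f x =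
    \sum_(k < n) \int[mu]_(x in `[grid R n k, grid R n k.+1]) f x)%E.
Proof.
move=> n0 mf f0; rewrite -(ge0_integral_itv_subdivision (p := grid R n))//.
  by rewrite grid0 gridn.
exact: le_grid.
Qed.

(** The variation of the regularised profile on a cell does not depend on where
    its centre [s] lies, so the estimate is uniform in [s]. *)
Lemma integral_midpoint_gauge_regular (a l d s : R) n : (0 < n)%N -> 0 < a ->
  0 <= l <= 1 -> 0 < d -> 0 <= s <= 2 * pi ->
  (\int[mu]_(t in I) ((midpoint_gauge a n t)%:E * profile l d (t - s)) <=
   ((pi / n%:R) `^ a * ((1 + 2 * (pi / n%:R) / d) / (a + 1)))%:E * total_mass l d)%E.
Proof.
move=> n0 a0 l01 d0 sI; set r := pi / n%:R.
have r0 : 0 < r by rewrite /r divr_gt0 ?pi_gt0// ltr0n.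
have mh : measurable_fun setT (fun t : R => profile l d (t - s)).
  by apply: (measurableT_comp (measurable_profile l d)); exact: measurable_funB.
have h0 (t : R) : (0 <= profile l d (t - s))%E by exact: profile_ge0.
have mg : measurable_fun setT (fun t => (midpoint_gauge a n t)%:E).
  by apply/measurable_EFinP; exact: measurable_midpoint_gauge.
rewrite (integral_subdivision_grid n0); last 2 first.
- exact: emeasurable_funM.
- by move=> t; rewrite mule_ge0// lee_fin midpoint_gauge_ge0.
rewrite -(integral_profile_shift l d sI) (integral_subdivision_grid n0)//.
rewrite ge0_sume_distrr; last by move=> k _; apply: integral_ge0.
apply: lee_sum => k _; rewrite grid_midl grid_midr -/r.
apply: (@le_trans _ _ (\int[mu]_(t in `[(midpoint R n k - r)%R, (midpoint R n k + r)%R])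
    ((`|t - midpoint R n k| `^ a)%:E * profile l d (t - s)))%E).
  apply: ge0_le_integral => //=.
  - by move=> t _; rewrite mule_ge0// lee_fin midpoint_gauge_ge0.
  - by apply: measurable_funTS; exact: emeasurable_funM.
  - apply: measurable_funTS; apply: emeasurable_funM => //.
    by apply/measurable_EFinP; exact: measurable_dist_powR.
  - by move=> t _; rewrite lee_wpmul2r// lee_fin midpoint_gauge_le.
have c0 : 0 <= 1 + 2 * r / d by have := divr_gt0 r0 d0; lra.
apply: integral_cell_harnack => // t u; rewrite !in_itv/= => /andP[t1 t2] /andP[u1 u2].
apply: (le_trans (profile_harnack (t - s) (u - s) l01 d0)).
rewrite lee_wpmul2r// lee_fin lerD2l ler_wpM2r ?invr_ge0 ?(ltW d0)//.
by rewrite ler_norml; lra.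
Qed.

(** For the singular profile, the part lost by the regularisation is estimated
    by the maximum [(pi / n) `^ a] of the oscillating factor. *)
Lemma integral_midpoint_gauge (a l d q s : R) n : (0 < n)%N -> 0 < a ->
  0 < l <= 1 -> 0 < d -> 0 <= q <= 1 -> 0 <= s <= 2 * pi ->
  (\int[mu]_(t in I) ((midpoint_gauge a n t)%:E * profile l 0 (t - s)) <=
   ((pi / n%:R) `^ a)%:E *
   (((1 + 2 * (pi / n%:R) / d) / (a + 1))%:E * total_mass l 0 +
    (d `^ q)%:E * total_mass (l + q) 0))%E.
Proof.
move=> n0 a0 l01 d0 q01 sI; have /andP[l0 l1] := l01; have /andP[q0 q1] := q01.
have l01' : 0 <= l <= 1 by rewrite l1 ltW.
set r := pi / n%:R.
have r0 : 0 < r by rewrite /r divr_gt0 ?pi_gt0// ltr0n.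
have mh l' d' : measurable_fun setT (fun t : R => profile l' d' (t - s)).
  by apply: (measurableT_comp (measurable_profile l' d')); exact: measurable_funB.
have mg : measurable_fun setT (fun t => (midpoint_gauge a n t)%:E).
  by apply/measurable_EFinP; exact: measurable_midpoint_gauge.
have g0 t : (0 <= (midpoint_gauge a n t)%:E)%E by rewrite lee_fin midpoint_gauge_ge0.
have H0 l' d' (t : R) : (0 <= profile l' d' (t - s))%E by exact: profile_ge0.
have ra0 : (0 <= (r `^ a)%:E)%E by rewrite lee_fin powR_ge0.
have dq0 : (0 <= (d `^ q)%:E)%E by rewrite lee_fin powR_ge0.
apply: (@le_trans _ _ (\int[mu]_(t in I)
   ((midpoint_gauge a n t)%:E * profile l d (t - s)%R +
    (r `^ a * d `^ q)%:E * profile (l + q) 0 (t - s)%R))%E).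
  apply: ge0_le_integral => //=.
  - by move=> t _; rewrite mule_ge0.
  - by apply: measurable_funTS; exact: (emeasurable_funM mg (mh l 0)).
  - apply: measurable_funTS; apply: emeasurable_funD.
      exact: (emeasurable_funM mg (mh l d)).
    exact: (measurable_funeM _ (mh _ _)).
  - move=> t _.
    apply: (@le_trans _ _ ((midpoint_gauge a n t)%:E *
      (profile l d (t - s)%R + (d `^ q)%:E * profile (l + q) 0 (t - s)%R))%E).
      by rewrite lee_wpmul2l// profile_split.
    rewrite ge0_muleDr ?mule_ge0// leeD2l// muleA -EFinM lee_wpmul2r// lee_fin.
    by rewrite ler_wpM2r ?powR_ge0// midpoint_gauge_le_cap.
rewrite ge0_integralD//=; last 4 first.
- by move=> t _; rewrite mule_ge0.
- by apply: measurable_funTS; exact: (emeasurable_funM mg (mh l d)).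
- by move=> t _; rewrite mule_ge0// lee_fin mulr_ge0// powR_ge0.
- by apply: measurable_funTS; exact: (measurable_funeM _ (mh _ _)).
have tm0 l' d' : (0 <= total_mass l' d' :> \bar R)%E by apply: integral_ge0 => t _; exact: profile_ge0.
have c0 : 0 <= (1 + 2 * r / d) / (a + 1).
  by have := divr_gt0 r0 d0 => rd0; apply: divr_ge0; lra.
rewrite ge0_muleDr ?mule_ge0//; apply: leeD.
  have widen (A C : R) (X Y Z : \bar R) : 0 <= A -> 0 <= C -> (Y <= Z)%E ->
      (X <= (A * C)%:E * Y)%E -> (X <= A%:E * (C%:E * Z))%E.
    move=> A0 C0 YZ /le_trans; apply; rewrite EFinM -muleA.
    by do 2!rewrite lee_wpmul2l ?lee_fin//.
  apply: (widen _ _ _ _ _ (powR_ge0 _ _) c0 _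
    (integral_midpoint_gauge_regular n0 a0 l01' d0 sI)).
  by apply: total_mass_le; exact: ltW.
rewrite ge0_integralZl//=; last 2 first.
- by apply: measurable_funTS; exact: mh.
- by rewrite lee_fin mulr_ge0// powR_ge0.
by rewrite integral_profile_shift// EFinM -muleA.
Qed.

End UniformEstimate.

(** * Integrals over the square against the kernel *)

Section TwoDim.
Context {R : realType}.
Notation mu := (@lebesgue_measure R).
Notation I := (`[0%R, (2 * pi)%R]%classic : set R).
Notation D := (square R).

Lemma measurable_square : measurable D.
Proof. by apply: measurableX. Qed.

Lemma measurable_cell n k l : measurable (cell R n k l).
Proof. by apply: measurableX. Qed.

Lemma measurable_singular_kernel (l : R) s :
  measurable_fun setT (fun z => singular_kernel l z s).
Proof.
have -> : (fun z => singular_kernel l z s) =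
    (@reg_kernel R l 0) \o (fun z => (z.1 - s.1, z.2 - s.2)).
  by apply/funext => z; rewrite singular_kernelE.
apply: measurableT_comp; first exact: measurable_reg_kernel.
by apply: measurable_fun_pair => /=; apply: measurable_funB.
Qed.

Lemma singular_kernel_ge0 (l : R) z s : 0 <= singular_kernel l z s.
Proof. by rewrite invr_ge0 powR_ge0. Qed.

Lemma square_pair (s : R * R) : D s -> 0 <= s.1 <= 2 * pi /\ 0 <= s.2 <= 2 * pi.
Proof. by rewrite /square/= !in_itv/=. Qed.

Lemma integral_scaled_kernel_shift (l u c s : R) : 0 <= c -> 0 <= s <= 2 * pi ->
  (\int[mu]_(v in I) (c * reg_kernel l 0 (u, v - s)%R)%:E = c%:E * profile l 0 u)%E.
Proof.
move=> c0 sI; rewrite -(integral_reg_kernel_shift l 0 u sI).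
under eq_integral do rewrite EFinM.
apply: ge0_integralZl_EFin => //.
- by move=> v _; rewrite lee_fin reg_kernel_ge0.
- apply: measurable_funTS; apply: (measurableT_comp (measurable_reg_kernelr l 0 u)).
  exact: measurable_funB.
Qed.

Lemma ge0_integral_mul_kernel1 (l : R) (s : R * R) (a : R -> R) : D s ->
  measurable_fun setT a -> (forall t, 0 <= a t) ->
  (\int[leb2 R]_(z in D) (a z.1 * singular_kernel l z s)%:E =
   \int[mu]_(t in I) ((a t)%:E * profile l 0 (t - s.1)))%E.
Proof.
move=> /square_pair[s1 s2] ma a0.
rewrite /square ge0_integral_setX//; last 2 first.
- apply/measurable_EFinP; apply: measurable_funM.
    exact: (measurableT_comp ma).
  exact: measurable_singular_kernel.
- by move=> z; rewrite lee_fin mulr_ge0// singular_kernel_ge0.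
apply: eq_integral => t _ /=.
rewrite -(integral_scaled_kernel_shift l (t - s.1) (a0 t) s2).
by apply: eq_integral => v _; rewrite singular_kernelE.
Qed.

Lemma ge0_integral_mul_kernel2 (l : R) (s : R * R) (a : R -> R) : D s ->
  measurable_fun setT a -> (forall t, 0 <= a t) ->
  (\int[leb2 R]_(z in D) (a z.2 * singular_kernel l z s)%:E =
   \int[mu]_(t in I) ((a t)%:E * profile l 0 (t - s.2)))%E.
Proof.
move=> /square_pair[s1 s2] ma a0.
have mF : measurable_fun setT (fun z : R * R => (a z.2 * singular_kernel l z s)%:E).
  apply/measurable_EFinP; apply: measurable_funM.
    exact: (measurableT_comp ma).
  exact: measurable_singular_kernel.
have F0 (z : R * R) : (0 <= (a z.2 * singular_kernel l z s)%:E)%E.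
  by rewrite lee_fin mulr_ge0// singular_kernel_ge0.
rewrite /square ge0_integral_setX//.
rewrite (ge0_integral_swap (F := fun z : R * R => (a z.2 * singular_kernel l z s)%:E))//.
apply: eq_integral => t _ /=.
rewrite -(integral_scaled_kernel_shift l (t - s.2) (a0 t) s1).
by apply: eq_integral => v _; rewrite singular_kernelE reg_kernelC.
Qed.

Lemma ge0_integral_split_kernel (l : R) (s : R * R) (a b : R -> R) : D s ->
  measurable_fun setT a -> (forall t, 0 <= a t) ->
  measurable_fun setT b -> (forall t, 0 <= b t) ->
  (\int[leb2 R]_(z in D) ((a z.1 + b z.2) * singular_kernel l z s)%:E =
   \int[mu]_(t in I) ((a t)%:E * profile l 0 (t - s.1)) +
   \int[mu]_(t in I) ((b t)%:E * profile l 0 (t - s.2)))%E.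
Proof.
move=> sD ma a0 mb b0.
have mD := measurable_square.
transitivity (\int[leb2 R]_(z in D) (a z.1 * singular_kernel l z s)%:E +
  \int[leb2 R]_(z in D) (b z.2 * singular_kernel l z s)%:E)%E; last first.
  congr (_ + _)%E.
    exact: ge0_integral_mul_kernel1.
  exact: ge0_integral_mul_kernel2.
rewrite -ge0_integralD//=.
- by apply: eq_integral => z _; rewrite mulrDl EFinD.
- by move=> z _; rewrite lee_fin mulr_ge0// singular_kernel_ge0.
- apply: measurable_funTS; apply/measurable_EFinP; apply: measurable_funM.
    exact: (measurableT_comp ma).
  exact: measurable_singular_kernel.
- by move=> z _; rewrite lee_fin mulr_ge0// singular_kernel_ge0.
- apply: measurable_funTS; apply/measurable_EFinP; apply: measurable_funM.
    exact: (measurableT_comp mb).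
  exact: measurable_singular_kernel.
Qed.

Lemma integral_singular_kernel (l : R) (s : R * R) : D s ->
  (\int[leb2 R]_(z in D) (singular_kernel l z s)%:E = total_mass l 0)%E.
Proof.
move=> sD; have [s1 s2] := square_pair sD.
rewrite -(integral_profile_shift _ _ s1).
under [RHS]eq_integral do rewrite -[profile _ _ _]mul1e.
rewrite -(@ge0_integral_mul_kernel1 l s (cst 1))//.
by apply: eq_integral => z _; rewrite mul1r.
Qed.

Lemma integrable_singular_kernel (l : R) (s : R * R) : 0 < l < 1 -> D s ->
  (leb2 R).-integrable D (fun z => (singular_kernel l z s)%:E).
Proof.
move=> l01 sD; apply/integrableP; split.
  by apply: measurable_funTS; apply/measurable_EFinP; exact: measurable_singular_kernel.
under eq_integral do rewrite gee0_abs ?lee_fin ?singular_kernel_ge0//.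
by rewrite integral_singular_kernel// total_mass_lty.
Qed.

Lemma integrable_mul_kernel (l : R) (s : R * R) (f : R * R -> R) (C : R) :
  0 < l < 1 -> D s -> measurable_fun D f -> (forall z, D z -> `|f z| <= C) ->
  (leb2 R).-integrable D (fun z => (f z * singular_kernel l z s)%:E).
Proof.
move=> l01 sD mf fC; have mD := measurable_square.
have iC : (leb2 R).-integrable D (fun z => (C%:E * (singular_kernel l z s)%:E)%E).
  by apply: integrableZl => //; exact: integrable_singular_kernel.
apply: le_integrable iC => //.
- apply/measurable_EFinP; apply: measurable_funM => //.
  by apply: measurable_funTS; exact: measurable_singular_kernel.
- move=> z Dz; rewrite /= !lee_fin !normrM ler_wpM2r// (le_trans (fC _ Dz))//.
  exact: ler_norm.
Qed.

Lemma ge0_integral_cells n (F : R * R -> \bar R) : (0 < n)%N ->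
  measurable_fun setT F -> (forall z, (0 <= F z)%E) ->
  (\int[leb2 R]_(z in D) F z =
    \sum_(k < n) \sum_(j < n) \int[leb2 R]_(z in cell R n k j) F z)%E.
Proof.
move=> n0 mF F0; rewrite /square ge0_integral_setX//.
rewrite (integral_subdivision_grid n0); last 2 first.
- exact: ge0_measurable_integralr.
- by move=> t; apply: integral_ge0.
apply: eq_bigr => k _; under eq_integral.
  move=> t _; rewrite (integral_subdivision_grid n0); last 2 first.
  - exact: (measurableT_comp mF (pair1_measurable t)).
  - by [].
  over.
rewrite ge0_integral_sum//=.
- by apply: eq_bigr => j _; rewrite /cell ge0_integral_setX.
- by move=> j; apply: measurable_funTS; apply: ge0_measurable_integralr.
- by move=> j t _; apply: integral_ge0.
Qed.

Lemma cell_square n (k j : 'I_n) : cell R n k j `<=` D.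
Proof.
move=> z; rewrite /cell /square/= !in_itv/= => -[/andP[a b] /andP[c d]].
have /andP[k0 _] := @grid_in R n k (ltnW (ltn_ord k)).
have /andP[_ k1] := @grid_in R n k.+1 (ltn_ord k).
have /andP[j0 _] := @grid_in R n j (ltnW (ltn_ord j)).
have /andP[_ j1] := @grid_in R n j.+1 (ltn_ord j).
split; apply/andP; split.
- exact: le_trans a.
- exact: le_trans k1.
- exact: le_trans c.
- exact: le_trans j1.
Qed.

(** The cells overlap on null sets; for integrands of variable sign the
    positive and negative parts are decomposed separately. *)
Lemma Rintegral_cells n (F : R * R -> R) : (0 < n)%N ->
  (leb2 R).-integrable D (EFin \o F) ->
  \int[leb2 R]_(z in D) F z =
    \sum_(k < n) \sum_(j < n) \int[leb2 R]_(z in cell R n k j) F z.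
Proof.
move=> n0 iF; have mD := measurable_square.
pose F' := (EFin \o F) \_ D.
have iF' : (leb2 R).-integrable setT F' by rewrite -integrable_mkcond.
have mF' : measurable_fun setT F' := measurable_int _ iF'.
have toF' (A : set (R * R)) : A `<=` D ->
    (\int[leb2 R]_(z in A) (F z)%:E = \int[leb2 R]_(z in A) F' z)%E.
  by move=> AD; apply: eq_integral => z /[!inE] /AD zD; rewrite /F' patchE mem_set.
have RE (A : set (R * R)) : measurable A -> A `<=` D ->
    \int[leb2 R]_(z in A) F z =
    fine (\int[leb2 R]_(z in A) F'^\+ z) - fine (\int[leb2 R]_(z in A) F'^\- z).
  move=> mA AD; rewrite /Rintegral toF'// integralE fineB//.
  - apply: integrable_pos_fin_num => //; exact: integrableS iF'.
  - apply: integrable_neg_fin_num => //; exact: integrableS iF'.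
rewrite RE// (ge0_integral_cells n0); last 2 first.
- exact: measurable_funepos.
- by [].
rewrite (@ge0_integral_cells n (F'^\-)%E n0); last 2 first.
- exact: measurable_funeneg.
- by [].
have cellfin k j : (leb2 R).-integrable (cell R n k j) F'.
  by apply: integrableS iF' => //; exact: measurable_cell.
have finp k j : (\int[leb2 R]_(z in cell R n k j) F'^\+ z)%E \is a fin_num.
  by apply: integrable_pos_fin_num => //; exact: measurable_cell.
have finn k j : (\int[leb2 R]_(z in cell R n k j) F'^\- z)%E \is a fin_num.
  by apply: integrable_neg_fin_num => //; exact: measurable_cell.
have sumE (f : 'I_n -> 'I_n -> \bar R) : (forall k j, f k j \is a fin_num) ->
    fine (\sum_(k < n) \sum_(j < n) f k j)%E = \sum_(k < n) \sum_(j < n) fine (f k j).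
  move=> ff; rewrite -sum_fine => [|k _]; last by apply/sum_fin_numP.
  by apply: eq_bigr => k _; rewrite -sum_fine.
rewrite !sumE// -sumrB; apply: eq_bigr => k _; rewrite -sumrB; apply: eq_bigr => j _.
by rewrite RE//; [exact: measurable_cell|exact: cell_square].
Qed.

End TwoDim.

(** * Functions of the Hoelder class *)

Section Holder.
Context {R : realType}.
Notation D := (square R).
Implicit Types (a : R) (f : R * R -> R).

Lemma near_grid n (t : R) : (0 < n)%N -> 0 <= t <= 2 * pi ->
  exists k : 'I_n.+1, `|t - grid R n k| <= 2 * pi / n%:R.
Proof.
move=> n0 /andP[t0 t1]; have pi0 := pi_gt0 R.
have n0' : 0 < n%:R :> R by rewrite ltr0n.
have h0 : 0 < 2 * pi / n%:R :> R by rewrite divr_gt0// mulr_gt0.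
pose x := t * n%:R / (2 * pi).
have x0 : 0 <= x by rewrite divr_ge0// ?mulr_ge0// ltW.
have pi2 : 2 * pi != 0 :> R by rewrite gt_eqF// mulr_gt0.
have tE : t = x * (2 * pi / n%:R).
  by rewrite /x mulrA divfK// mulfK// gt_eqF.
have /andP[kx xk] := truncn_itv x0.
have kn : (Num.trunc x < n.+1)%N.
  rewrite ltnS -(ler_nat R) (le_trans kx)// ler_pdivrMr ?mulr_gt0//.
  by rewrite mulrC ler_wpM2l.
exists (Ordinal kn); rewrite /grid /= [X in X - _]tE.
have swap (T p y : R) : 2 * T * p * y = T * (2 * p * y) by ring.
rewrite swap.
rewrite -mulrBl normrM (gtr0_norm h0) ler_piMl ?(ltW h0)//.
by move: xk; rewrite -natr1 ler_norml; lra.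
Qed.

Lemma holder_bounded a f : 0 < a -> holder_class a f ->
  forall z, D z -> `|f z| <= `|f (0, 0)| + 2 * (2 * pi) `^ a.
Proof.
move=> a0 hf z Dz; have pi0 := pi_gt0 R.
have D0 : D (0, 0) by rewrite /square/= !in_itv/= lexx mulr_ge0// ltW.
have [/andP[z10 z11] /andP[z20 z21]] := square_pair Dz.
have p t : 0 <= t -> t <= 2 * pi -> `|t - 0| `^ a <= (2 * pi) `^ a.
  move=> t0 t1; rewrite subr0 ger0_norm// ge0_ler_powR ?(ltW a0)// nnegrE//.
  by rewrite mulr_ge0// ltW.
have := hf _ _ Dz D0; rewrite /= => h.
have := p _ z10 z11; have := p _ z20 z21 => p2 p1.
have := ler_normD (f z - f (0, 0)) (f (0, 0)); rewrite subrK; lra.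
Qed.

(** [f] is the limit of the minima, over the nodes [p] of finer and finer grids,
    of the cones [f p + |z_1 - p_1|^a + |z_2 - p_2|^a]: each of them lies above
    [f] by the Hoelder condition, and the one based at a node near [z] is close
    to [f z].  A cone is a sum of functions of one variable, so its
    measurability does not involve open sets of the plane. *)
Lemma measurable_holder a f : 0 < a -> holder_class a f -> measurable_fun D f.
Proof.
move=> a0 hf; have pi0 := pi_gt0 R.
pose cone (p : R * R) (z : R * R) := f p + (`|z.1 - p.1| `^ a + `|z.2 - p.2| `^ a).
have mcone p : measurable_fun setT (cone p).
  apply: measurable_funD => //; apply: measurable_funD.
  - exact: (measurableT_comp (measurable_dist_powR a p.1) measurable_fst).
  - exact: (measurableT_comp (measurable_dist_powR a p.2) measurable_snd).
pose h n z := \big[Order.min/cone (0, 0) z]_(p : 'I_n.+3 * 'I_n.+3)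
  cone (grid R n.+2 p.1, grid R n.+2 p.2) z.
have Dgrid n (i j : 'I_n.+3) : D (grid R n.+2 i, grid R n.+2 j).
  by rewrite /square/= !in_itv/= !grid_in// -ltnS.
have D0 : D (0, 0) by rewrite /square/= !in_itv/= lexx mulr_ge0// ltW.
have mh n : measurable_fun setT (h n).
  rewrite /h; elim: (index_enum _) => [|p s IH].
    by under eq_fun do rewrite big_nil; exact: mcone.
  by under eq_fun do rewrite big_cons; exact: measurable_minr.
apply: (@measurable_fun_cvg _ _ R D h f) => [n|z Dz].
  exact: measurable_funTS.
have fcone p : D p -> f z <= cone p z.
  by move=> Dp; have := hf _ _ Dz Dp; rewrite ler_norml /cone; lra.
have [z1 z2] := square_pair Dz.
have lower n : f z <= h n z.
  by rewrite /h; apply: (big_ind (fun y => f z <= y)) => [|u v hu hv|p _];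
    [exact: fcone|rewrite le_min hu|exact: fcone].
have upper n : h n z <= f z + 4 * (2 * pi / n.+2%:R) `^ a.
  have [i hi] := near_grid (ltn0Sn n.+1) z1.
  have [j hj] := near_grid (ltn0Sn n.+1) z2.
  have hz : h n z <= cone (grid R n.+2 i, grid R n.+2 j) z.
    by rewrite /h (bigD1 (i, j))//= ge_min lexx.
  apply: (le_trans hz); rewrite /cone/=.
  have := hf _ _ Dz (Dgrid n i j); rewrite /= => /ler_normlP[+ _].
  have p (t : R) : `|t| <= 2 * pi / n.+2%:R -> `|t| `^ a <= (2 * pi / n.+2%:R) `^ a.
    move=> ht; rewrite ge0_ler_powR ?(ltW a0)// nnegrE//.
    exact: le_trans ht.
  have := p _ hi; have := p _ hj; lra.
apply: (@squeeze_cvgr _ _ _ _ (fun=> f z) (fun n => f z + 4 * (2 * pi / n.+2%:R) `^ a)).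
- by apply: nearW => n; rewrite lower upper.
- exact: cvg_cst.
- rewrite -[X in _ --> X]addr0; apply: cvgD; first exact: cvg_cst.
  rewrite -(mulr0 4); apply: cvgMr; apply: cvg_powR_div => //.
  by rewrite mulr_gt0.
Qed.

End Holder.

(** * Upper bound for the midpoint formula *)

Section Bounds.
Context {R : realType}.
Notation mu := (@lebesgue_measure R).
Notation I := (`[0%R, (2 * pi)%R]%classic : set R).
Notation D := (square R).
Implicit Types (a l d q : R) (f : R * R -> R).

Lemma total_mass_gamma l : 0 < l < 1 -> total_mass l 0 = (gamma l)%:E.
Proof.
move=> l01; rewrite /gamma /Rintegral fineK.
  by rewrite total_massE; apply: eq_integral => z _; rewrite /reg_kernel addr0.
rewrite -[X in X \is a fin_num](_ : total_mass l 0 = _); last first.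
  by rewrite total_massE; apply: eq_integral => z _; rewrite /reg_kernel addr0.
rewrite ge0_fin_numE ?total_mass_lty//.
by apply: integral_ge0 => t _; exact: profile_ge0.
Qed.

Lemma gamma_gt0 l : 0 < l < 1 -> 0 < gamma l.
Proof.
move=> l01; rewrite -lte_fin -total_mass_gamma// total_mass_gt0//.
by move: l01 => /andP[/ltW-> /ltW->].
Qed.

Lemma remainder_midpoint_cells l n f s : 0 < l < 1 -> (0 < n)%N -> D s ->
  (leb2 R).-integrable D (fun z => (f z * singular_kernel l z s)%:E) ->
  remainder l (midpoint_cubature l n) f s =
  \sum_(k < n) \sum_(j < n) \int[leb2 R]_(z in cell R n k j)
    ((f z - f (midpoint R n k, midpoint R n j)) * singular_kernel l z s).
Proof.
move=> l01 n0 sD intf.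
have intk := integrable_singular_kernel l01 sD.
rewrite /remainder /Kop (Rintegral_cells n0 intf) -sumrB; apply: eq_bigr => k _.
rewrite -sumrB; apply: eq_bigr => j _ /=.
have mC := @measurable_cell R n k j.
have intkC : (leb2 R).-integrable (cell R n k j) (fun z => (singular_kernel l z s)%:E).
  by apply: integrableS intk => //; [exact: measurable_square|exact: cell_square].
have intfC : (leb2 R).-integrable (cell R n k j) (fun z => (f z * singular_kernel l z s)%:E).
  by apply: integrableS intf => //; [exact: measurable_square|exact: cell_square].
have intcC : (leb2 R).-integrable (cell R n k j)
    (fun z => ((f (midpoint R n k, midpoint R n j))%:E * (singular_kernel l z s)%:E)%E).
  exact: integrableZl.
rewrite mulrC -RintegralZl// -RintegralB//=.
  by apply: eq_Rintegral => z _; rewrite mulrBl.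
Qed.

(** The bound does not depend on [s]; [d] and [q] are free parameters, to be
    tuned to [n]. *)
Lemma remainder_midpoint_le a l d q n f s :
  0 < a <= 1 -> 0 < l < 1 -> 0 < d -> 0 <= q -> l + q < 1 -> (0 < n)%N ->
  holder_class a f -> D s ->
  `|remainder l (midpoint_cubature l n) f s| <=
    2 * ((pi / n%:R) `^ a * ((1 + 2 * (pi / n%:R) / d) / (a + 1) * gamma l
       + d `^ q * gamma (l + q))).
Proof.
move=> a01 l01 d0 q0 lq n0 hf sD; have /andP[a0 a1] := a01; have /andP[l0 l1] := l01.
pose Phi (z : R * R) := midpoint_gauge a n z.1 + midpoint_gauge a n z.2.
have mg := @measurable_midpoint_gauge R a n.
have mPhi : measurable_fun setT Phi.
  apply: measurable_funD.
  - exact: (measurableT_comp mg measurable_fst).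
  - exact: (measurableT_comp mg measurable_snd).
have Phi0 z : 0 <= Phi z by rewrite addr_ge0// midpoint_gauge_ge0.
have intf : (leb2 R).-integrable D (fun z => (f z * singular_kernel l z s)%:E).
  apply: integrable_mul_kernel => //; first exact: measurable_holder hf.
  exact: holder_bounded hf.
have intPhi : (leb2 R).-integrable D (fun z => (Phi z * singular_kernel l z s)%:E).
  apply: (@integrable_mul_kernel _ _ _ _ (2 * (pi / n%:R) `^ a)) => //.
    exact: measurable_funTS.
  move=> z _; rewrite ger0_norm// /Phi.
  by have := midpoint_gauge_le_cap a n z.1; have := midpoint_gauge_le_cap a n z.2; lra.
rewrite remainder_midpoint_cells//.
apply: (@le_trans _ _ (\int[leb2 R]_(z in D) (Phi z * singular_kernel l z s))).
  rewrite (Rintegral_cells n0 intPhi).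
  apply: (le_trans (ler_norm_sum _ _ _)); apply: ler_sum => k _.
  apply: (le_trans (ler_norm_sum _ _ _)); apply: ler_sum => j _.
  have mC := @measurable_cell R n k j.
  have CD := @cell_square R n k j.
  have intd : (leb2 R).-integrable (cell R n k j) (fun z =>
      ((f z - f (midpoint R n k, midpoint R n j)) * singular_kernel l z s)%:E).
    under eq_fun do rewrite mulrBl EFinB.
    apply: integrableB => //.
    - by apply: integrableS intf => //; exact: measurable_square.
    - apply: (@integrableZl _ _ _ (leb2 R) _ mC _ (fun z => (singular_kernel l z s)%:E)).
      apply: integrableS (integrable_singular_kernel l01 sD) => //.
      exact: measurable_square.
  apply: (@le_trans _ _ (\int[leb2 R]_(z in cell R n k j)
      `|(f z - f (midpoint R n k, midpoint R n j)) * singular_kernel l z s|)).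
    exact: le_normr_Rintegral.
  apply: le_Rintegral => //.
  - by have := integrable_abse intd; congr integrable.
  - by apply: integrableS intPhi => //; exact: measurable_square.
  move=> z Cz; rewrite normrM (ger0_norm (singular_kernel_ge0 _ _ _)).
  rewrite ler_wpM2r ?singular_kernel_ge0//.
  have Dm : D (midpoint R n k, midpoint R n j) by rewrite /square/= !in_itv/= !midpoint_in.
  apply: (le_trans (hf _ _ (CD _ Cz) Dm)) => /=.
  move: Cz; rewrite /cell/= !in_itv/= => -[z1 z2].
  by apply: lerD; apply: midpoint_gauge_ge => //; exact: ltW.
have l01' : 0 < l <= 1 by rewrite l0 ltW.
have q01 : 0 <= q <= 1 by apply/andP; split; lra.
have lq01 : 0 < l + q < 1 by apply/andP; split; lra.
have [s1 s2] := square_pair sD.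
have half (u : R) : 0 <= u <= 2 * pi ->
    (\int[mu]_(t in I) ((midpoint_gauge a n t)%:E * profile l 0 (t - u)) <=
    ((pi / n%:R) `^ a * ((1 + 2 * (pi / n%:R) / d) / (a + 1) * gamma l
       + d `^ q * gamma (l + q)))%:E)%E.
  move=> uI; have := integral_midpoint_gauge n0 a0 l01' d0 q01 uI.
  by rewrite !total_mass_gamma// -!EFinM -EFinD -EFinM.
rewrite /Rintegral -lee_fin fineK; last first.
  by apply: integrable_fin_num => //; exact: measurable_square.
rewrite (ge0_integral_split_kernel l sD mg (midpoint_gauge_ge0 a n) mg (midpoint_gauge_ge0 a n)).
apply: (le_trans (leeD (half _ s1) (half _ s2))).
by rewrite -EFinD lee_fin -mulr2n [leRHS]mulr_natl.
Qed.

End Bounds.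

(** * Lower bound for every cubature formula *)

Section LowerBound.
Context {R : realType}.
Notation mu := (@lebesgue_measure R).
Notation I := (`[0%R, (2 * pi)%R]%classic : set R).
Notation D := (square R).
Implicit Types (a l : R).

(** A bound for all translates bounds their mean over the translation [u], and by
    Tonelli that mean decouples into the mass of the profile times the integral
    of [c]. *)
Lemma averaged_profile_le l (c : R -> R) (E : \bar R) :
  measurable_fun setT c -> (forall t, 0 <= c t) ->
  (forall u, I u -> (\int[mu]_(t in I) ((c t)%:E * profile l 0 (t - u)) <= E)%E) ->
  (total_mass l 0 * \int[mu]_(t in I) (c t)%:E <= E * (2 * pi)%:E)%E.
Proof.
move=> mc c0 hE; have pi0 := pi_gt0 R.
have mI : measurable I by exact: measurable_itv.
have mc' : measurable_fun setT (fun t => (c t)%:E) by exact/measurable_EFinP.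
pose F (z : R * R) := ((c z.2)%:E * profile l 0 (z.2 - z.1))%E.
have mF : measurable_fun setT F.
  apply: emeasurable_funM.
    exact: (measurableT_comp mc' measurable_snd).
  by apply: (measurableT_comp (measurable_profile l 0)); exact: measurable_funB.
have F0 z : (0 <= F z)%E by rewrite mule_ge0 ?lee_fin ?profile_ge0.
have E0 : (0 <= E)%E.
  apply: le_trans (hE 0 _); last by rewrite /= in_itv/= lexx mulr_ge0// ltW.
  by apply: integral_ge0 => t _; rewrite mule_ge0 ?lee_fin ?profile_ge0.
have tm0 : (0 <= total_mass l 0 :> \bar R)%E.
  by apply: integral_ge0 => t _; exact: profile_ge0.
have muI : mu I = (2 * pi)%:E.
  rewrite lebesgue_measure_itv/= lte_fin ifT; last by rewrite mulr_gt0.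
  by rewrite -EFinB subr0.
rewrite -muI; apply: (@le_trans _ _ (\int[mu]_(u in I) \int[mu]_(t in I) F (u, t))%E).
  have -> := ge0_integral_swap mI mI mF F0.
  have <- : (\int[mu]_(t in I) (total_mass l 0 * (c t)%:E) =
      total_mass l 0 * \int[mu]_(t in I) (c t)%:E)%E.
    apply: ge0_integralZl => //; first exact: measurable_funTS.
    by move=> t _; rewrite lee_fin.
  rewrite le_eqVlt; apply/orP; left; apply/eqP.
  apply: eq_integral => t; rewrite inE /= in_itv/= => tI.
  rewrite -(integral_profile_shift_center l 0 tI) muleC /F /=; symmetry.
  apply: ge0_integralZl => //.
  - apply: measurable_funTS; apply: (measurableT_comp (measurable_profile l 0)).
    exact: measurable_funB.
  - by move=> u _; exact: profile_ge0.
  - by rewrite lee_fin.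
apply: (@le_trans _ _ (\int[mu]_(u in I) E)%E); last first.
  by rewrite (_ : \int[mu]_(u in I) E = E * mu I)%E//; exact: integral_cst.
apply: ge0_le_integral => //.
- by move=> u _; apply: integral_ge0.
- by apply: measurable_funTS; exact: ge0_measurable_integralr.
Qed.

Lemma class_error_ge a l n (C : cubature R n) :
  0 < a <= 1 -> 0 < l < 1 -> (0 < n)%N ->
  ((2 * gamma l * (pi / n%:R) `^ a / (a + 1))%:E <=
    class_error l C (holder_class a))%E.
Proof.
move=> a01 l01 n0; have /andP[a0 a1] := a01; have pi0 := pi_gt0 R.
have n0' : 0 < n%:R :> R by rewrite ltr0n.
pose r : R := pi / n%:R.
have r0 : 0 < r by rewrite divr_gt0.
have LE : 2 * pi = 2 * r * n%:R by rewrite /r -mulrA divfK// gt_eqF.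
pose A := node_gauge a (r `^ a) (xnode C).
pose B := node_gauge a (r `^ a) (ynode C).
have mA : measurable_fun setT A by exact: measurable_node_gauge.
have mB : measurable_fun setT B by exact: measurable_node_gauge.
have A0 t : 0 <= A t by rewrite node_gauge_ge0// powR_ge0.
have B0 t : 0 <= B t by rewrite node_gauge_ge0// powR_ge0.
pose f (z : R * R) := A z.1 + B z.2.
have hf : holder_class a f.
  move=> x y _ _; rewrite /f opprD addrACA (le_trans (ler_normD _ _))//.
  by apply: lerD; exact: node_gauge_holder.
have mf : measurable_fun setT f.
  apply: measurable_funD.
  - exact: (measurableT_comp mA measurable_fst).
  - exact: (measurableT_comp mB measurable_snd).
set E := class_error _ _ _.
have errf : (error_on l C f <= E)%E by apply: ereal_sup_ubound; exists f.
(* on the diagonal both variables see the same translate of the profile *)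
have hE (u : R) : I u ->
    (\int[mu]_(t in I) ((A t + B t)%:E * profile l 0 (t - u)) <= E)%E.
  rewrite /= in_itv/= => uI.
  have uD : D (u, u) by rewrite /square/= !in_itv/=.
  have intf : (leb2 R).-integrable D (fun z => (f z * singular_kernel l z (u, u))%:E).
    apply: (integrable_mul_kernel l01 uD (measurable_funTS mf)) => z Dz.
    exact: (holder_bounded a0 hf Dz).
  have -> : (\int[mu]_(t in I) ((A t + B t)%:E * profile l 0 (t - u)) =
      \int[leb2 R]_(z in D) (f z * singular_kernel l z (u, u))%:E)%E.
    rewrite (ge0_integral_split_kernel l uD mA A0 mB B0).
    have mprod (g : R -> R) : measurable_fun setT g ->
        measurable_fun I (fun t => ((g t)%:E * profile l 0 (t - u))%E).
      move=> mg; apply: measurable_funTS; apply: emeasurable_funM.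
        exact/measurable_EFinP.
      by apply: (measurableT_comp (measurable_profile l 0)); exact: measurable_funB.
    under eq_integral do rewrite EFinD ge0_muleDl ?lee_fin//.
    apply: ge0_integralD => //.
    - by move=> t _; rewrite mule_ge0 ?lee_fin ?profile_ge0.
    - exact: mprod.
    - by move=> t _; rewrite mule_ge0 ?lee_fin ?profile_ge0.
    - exact: mprod.
  apply: (@le_trans _ _ (Kop l f (u, u))%:E).
    by rewrite /Kop /Rintegral fineK//; apply: integrable_fin_num => //; exact: measurable_square.
  apply: le_trans errf; apply: (@le_trans _ _ (`|remainder l C f (u, u)|)%:E); last first.
    by apply: ereal_sup_ubound; exists (u, u).
  rewrite lee_fin (le_trans (ler_norm _))// /remainder big1 ?subr0// => k _.
  rewrite big1// => j _; rewrite /f/= /A /B !node_gauge_node ?powR_ge0//.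
  by rewrite addr0 mulr0.
have := @averaged_profile_le l (fun t => A t + B t) E.
move=> /(_ (measurable_funD mA mB) (fun t => addr_ge0 (A0 t) (B0 t)) hE).
have iA := @integral_node_gauge_ge R a (2 * pi) r n (xnode C) a0 r0 LE.
have iB := @integral_node_gauge_ge R a (2 * pi) r n (ynode C) a0 r0 LE.
have -> : (\int[mu]_(t in I) (A t + B t)%:E =
    \int[mu]_(t in I) (A t)%:E + \int[mu]_(t in I) (B t)%:E)%E.
  under eq_integral do rewrite EFinD.
  apply: ge0_integralD => //.
  - by move=> t _; rewrite lee_fin.
  - by apply: measurable_funTS; exact/measurable_EFinP.
  - by move=> t _; rewrite lee_fin.
  - by apply: measurable_funTS; exact/measurable_EFinP.
rewrite total_mass_gamma// => h.
have {h} : ((gamma l * (2 * (2 * pi * r `^ a / (a + 1))))%:E <= E * (2 * pi)%:E)%E.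
  apply: le_trans h; rewrite EFinM lee_wpmul2l ?lee_fin ?(ltW (gamma_gt0 l01))//.
  have dbl (x : R) : 2 * x = x + x by ring.
  by rewrite dbl EFinD; exact: (leeD iA iB).
rewrite -lee_pdivrMr ?mulr_gt0// => /(le_trans _); apply.
rewrite -/r -EFinM lee_fin le_eqVlt; apply/orP; left; apply/eqP.
have cancel (g p x y : R) : p != 0 -> y != 0 ->
    2 * g * x / y = g * (2 * (2 * p * x / y)) / (2 * p).
  by move=> p0 y0; field; rewrite p0.
by apply: cancel; rewrite gt_eqF//; lra.
Qed.
End LowerBound.

(** * Comparison of the two bounds *)

Section Rate.
Context {R : realType}.
Implicit Types (a l : R).

(** The relative gap between the two bounds for [d = sqrt (pi / n)] and
    [q = (1 - l) / 2]: the first term is [2 (pi / n) / d], the variation on a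
    cell, and the second one comes from [d `^ q]. *)
Definition excess a l (n : nat) : R :=
  2 * (pi / n%:R) `^ 2^-1 +
  (pi / n%:R) `^ (2^-1 * ((1 - l) / 2)) * (gamma (l + (1 - l) / 2) * (a + 1) / gamma l).

Lemma cvg_excess a l : l < 1 -> excess a l n @[n --> \oo] --> (0 : R).
Proof.
move=> l1; rewrite -(cvg_shiftn 2).
have -> : [sequence excess a l (n + 2)%N]_n = (fun n => excess a l n.+2).
  by apply/funext => n /=; rewrite addn2.
pose K := gamma (l + (1 - l) / 2) * (a + 1) / gamma l.
have c1 : (pi / n.+2%:R) `^ 2^-1 @[n --> \oo] --> (0 : R).
  by apply: cvg_powR_div; rewrite ?pi_gt0.
have c2 : (pi / n.+2%:R) `^ (2^-1 * ((1 - l) / 2)) @[n --> \oo] --> (0 : R).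
  by apply: cvg_powR_div; rewrite ?pi_gt0//; lra.
have := cvgD (cvgM (cvg_cst (2 : R)) c1) (cvgM c2 (cvg_cst K)).
rewrite mulr0 mul0r addr0; exact.
Qed.

Lemma class_error_midpoint_le a l n : 0 < a <= 1 -> 0 < l < 1 -> (0 < n)%N ->
  (class_error l (midpoint_cubature l n) (holder_class a) <=
   (2 * gamma l * (pi / n%:R) `^ a / (a + 1) * (1 + excess a l n))%:E)%E.
Proof.
move=> a01 l01 n0; have /andP[a0 a1] := a01; have /andP[l0 l1] := l01.
have pi0 := pi_gt0 R.
have n0' : 0 < n%:R :> R by rewrite ltr0n.
have r0 : 0 < pi / n%:R :> R by rewrite divr_gt0.
have g0 := gamma_gt0 l01.
apply: ge_ereal_sup => _ [f hf <-]; apply: ge_ereal_sup => _ [s sD <-].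
rewrite lee_fin.
have d0 : 0 < (pi / n%:R) `^ 2^-1 :> R by rewrite powR_gt0.
have q0 : 0 <= (1 - l) / 2 by lra.
have lq : l + (1 - l) / 2 < 1 by lra.
apply: (le_trans (remainder_midpoint_le a01 l01 d0 q0 lq n0 hf sD)).
rewrite /excess -powRrM.
have ratio : pi / n%:R / (pi / n%:R) `^ 2^-1 = (pi / n%:R) `^ 2^-1 :> R.
  rewrite -[X in X / _](powRr1 (ltW r0)) -powRB; last by rewrite (gt_eqF r0) implybT.
  by congr powR; lra.
have -> : 2 * (pi / n%:R) / (pi / n%:R) `^ 2^-1 = 2 * (pi / n%:R) `^ 2^-1 :> R.
  by rewrite -mulrA ratio.
have arrange (A g y x z w : R) : g != 0 -> y != 0 ->
    2 * (A * ((1 + x) / y * g + z * w)) = 2 * g * A / y * (1 + (x + z * (w * y / g))).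
  by move=> g0' y0; field; rewrite g0'.
by rewrite arrange// gt_eqF//; lra.
Qed.

End Rate.

Theorem theorem5p5 (R : realType) (lambda alpha : R)
    (lambda_gt0 : 0 < lambda) (lambda_lt1 : lambda < 1)
    (alpha_gt0 : 0 < alpha) (alpha_le1 : alpha <= 1) :
  (exists o1 : nat -> R,
     o1 n @[n --> \oo] --> (0 : R) /\
     forall n : nat, (0 < n)%N ->
       class_error lambda (midpoint_cubature lambda n) (holder_class alpha)
       = ((2 + o1 n) * gamma lambda / (1 + alpha)
          * (pi / n%:R) `^ alpha)%:E) /\
  asymptotically_optimal lambda (holder_class alpha)
    (midpoint_cubature lambda).
Proof.
have a01 : 0 < alpha <= 1 by rewrite alpha_gt0.
have l01 : 0 < lambda < 1 by rewrite lambda_gt0.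
have g0 := gamma_gt0 l01.
pose E n := class_error lambda (midpoint_cubature lambda n) (holder_class alpha).
pose Z n := zeta lambda n (holder_class alpha).
pose B n : R := 2 * gamma lambda * (pi / n%:R) `^ alpha / (alpha + 1).
pose e n := excess alpha lambda n.
have r0 n : (0 < n)%N -> 0 < pi / n%:R :> R.
  by move=> n0; rewrite divr_gt0 ?pi_gt0// ltr0n.
have B0 n : (0 < n)%N -> 0 < B n.
  by move=> /r0 rn; rewrite /B !mulr_gt0 ?powR_gt0// invr_gt0; lra.
have BZ n : (0 < n)%N -> ((B n)%:E <= Z n)%E.
  by move=> n0; apply: le_ereal_inf_tmp => _ [C _ <-]; exact: class_error_ge.
have ZE n : (Z n <= E n)%E.
  by apply: ereal_inf_lbound; exists (midpoint_cubature lambda n).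
have EU n : (0 < n)%N -> (E n <= (B n * (1 + e n))%:E)%E.
  by move=> n0; exact: class_error_midpoint_le.
have ce : e n @[n --> \oo] --> (0 : R) by exact: cvg_excess.
have Efin n : (0 < n)%N -> E n \is a fin_num.
  move=> n0; rewrite fin_real// (lt_le_trans (ltNyr (B n)) (le_trans (BZ _ n0) (ZE n)))/=.
  exact: le_lt_trans (EU _ n0) (ltry _).
have Zfin n : (0 < n)%N -> Z n \is a fin_num.
  move=> n0; rewrite fin_real// (lt_le_trans (ltNyr (B n)) (BZ _ n0))/=.
  exact: le_lt_trans (le_trans (ZE n) (EU _ n0)) (ltry _).
split.
(* solve [E n = B n * (1 + o1 n / 2)] for [o1 n] *)
- exists (fun n => 2 * (fine (E n) / B n - 1)); split.
    rewrite -[X in _ --> X](mulr0 2); apply: cvgMr.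
    apply: (@squeeze_cvgr _ _ _ _ (fun=> 0) e); [|exact: cvg_cst|exact: ce].
    near=> n; have n0 : (0 < n)%N by near: n; exists 1%N.
    have := EU _ n0; rewrite -(fineK (Efin _ n0)) lee_fin => h.
    have := le_trans (BZ _ n0) (ZE n); rewrite -(fineK (Efin _ n0)) lee_fin => h'.
    rewrite subr_ge0 ler_pdivlMr ?B0// mul1r h'/= lerBlDl ler_pdivrMr ?B0//.
    by rewrite mulrC.
  move=> n n0; rewrite -/(E n) -[LHS](fineK (Efin _ n0)); congr EFin.
  have rn : 0 < (pi / n%:R) `^ alpha :> R by rewrite powR_gt0 ?r0.
  rewrite /B.
  have arrange (x g y z : R) : g != 0 -> y != 0 -> z != 0 ->
      x = (2 + 2 * (x / (2 * g * z / y) - 1)) * g / y * z.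
    by move=> g0' y0 z0; field; rewrite g0' y0 z0.
  rewrite (addrC 1); apply: arrange; rewrite gt_eqF//; lra.
- rewrite /asymptotically_optimal.
  apply: (@cvg_trans _ ((fun n => (fine (E n) / fine (Z n))%:E) @ \oo)).
    apply: near_eq_cvg; near=> n; have n0 : (0 < n)%N by near: n; exists 1%N.
    rewrite -/(E n) -/(Z n) -[in RHS](fineK (Efin _ n0)) -[in RHS](fineK (Zfin _ n0)).
    rewrite inver gt_eqF -?EFinM//.
    by rewrite -lte_fin fineK ?Zfin// (lt_le_trans _ (BZ _ n0))// lte_fin B0.
  apply: cvg_EFin; first exact: nearW.
  apply: (@squeeze_cvgr _ _ _ _ (fun=> 1) (fun n => 1 + e n)).
  + near=> n; have n0 : (0 < n)%N by near: n; exists 1%N.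
    have := EU _ n0; rewrite -(fineK (Efin _ n0)) lee_fin => h.
    have := BZ _ n0; rewrite -(fineK (Zfin _ n0)) lee_fin => h'.
    have := ZE n; rewrite -(fineK (Efin _ n0)) -(fineK (Zfin _ n0)) lee_fin => h''.
    have z0 : 0 < fine (Z n) := lt_le_trans (B0 _ n0) h'.
    rewrite ler_pdivlMr// mul1r h'' /= ler_pdivrMr// (le_trans h)// mulrC.
    rewrite ler_wpM2l//.
    have : B n <= B n * (1 + e n) by exact: le_trans h' (le_trans h'' h).
    by rewrite ler_pMr ?B0//; apply: le_trans.
  + exact: cvg_cst.
  + by rewrite -[X in _ --> X]addr0; apply: cvgD; [exact: cvg_cst|exact: ce].
Unshelve. all: by end_near. Qed.
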